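(* Let $A$ be a unital semisimple (complex) Banach algebra with essential socle, let $B$ be a unital prime $C^*$-algebra with nonzero socle, and let $\Phi:A\to B$ be a surjective linear map. The following are equivalent: (1) For all $a,b\in A$: $a\leq^- b$ if and only if $\Phi(a)\leq^-\Phi(b)$. (2) $\Phi$ is either an isomorphism multiplied by an invertible element, or an anti-isomorphism multiplied by an invertible element; i.e. there exist an invertible $c\in B$ and a map $\Psi:A\to B$ which is an algebra isomorphism or an algebra anti-isomorphism such that $\Phi(x)=c\,\Psi(x)$ for all $x\in A$.
   Context: For a unital ring $R$, $R^\bullet$ is the set of idempotents, $\mathrm{ann}_l(a)=\{x\in R: xa=0\}$ and $\mathrm{ann}_r(a)=\{x\in R: ax=0\}$. For $a,b\in R$, $a\leq^- b$ means that there exist $p,q\in R^\bullet$ with $\mathrm{ann}_l(a)=\mathrm{ann}_l(p)$, $\mathrm{ann}_r(a)=\mathrm{ann}_r(q)$, $pa=pb$ and $aq=bq$. The socle $\mathrm{Soc}(A)$ of a semisimple Banach algebra $A$ is the sum of all minimal left ideals of $A$ (equivalently of all minimal right ideals), and is $\{0\}$ if there are none. A non-zero ideal $I$ is essential if it has non-zero intersection with every non-zero ideal of $A$; for semisimple $A$ this is equivalent to: $aI=0$ with $a\in A$ implies $a=0$. *)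

(* Defs.v *)
From HB Require Import structures.
From mathcomp Require Import all_boot all_order all_algebra.
From mathcomp Require Import complex.
From mathcomp Require Import boolp classical_sets reals topology normedtype.

Set Implicit Arguments.
Unset Strict Implicit.
Unset Printing Implicit Defensive.

Import Order.TTheory GRing.Theory Num.Theory.
Import numFieldNormedType.Exports.

Local Open Scope classical_set_scope.
Local Open Scope ring_scope.

(* The norm cannot be the library's `| x |: the structure Num.NumDomain is
   already the canonical join of rings and normed Z-modules. It is therefore
   named anew, and the type alias [normed_space A] carries the induced
   normedModType structure. As in normedModType K, the norm takes its values
   in K; these are nonnegative by lemma [normr_ge0] on the alias.
   The norm of 1 is not required to be 1. *)
HB.mixin Record Algebra_isNormed (K : numFieldType) A of GRing.Algebra K A := {
  algnorm : A -> K;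
  ler_algnormD : forall x y : A, algnorm (x + y) <= algnorm x + algnorm y;
  algnormZ : forall (k : K) (x : A), algnorm (k *: x) = `|k| * algnorm x;
  algnorm0_eq0 : forall x : A, algnorm x = 0 -> x = 0;
  ler_algnormM : forall x y : A, algnorm (x * y) <= algnorm x * algnorm y
}.

#[short(type="normedAlgType")]
HB.structure Definition NormedAlgebra (K : numFieldType) :=
  {A of GRing.Algebra K A & Algebra_isNormed K A}.

Definition normed_space (K : numFieldType) (A : normedAlgType K) : Type := A.

HB.instance Definition _ (K : numFieldType) (A : normedAlgType K) :=
  GRing.Lmodule.copy (normed_space A) A.
HB.instance Definition _ (K : numFieldType) (A : normedAlgType K) :=
  Lmodule_isNormed.Build K (normed_space A)
    (@ler_algnormD K A) (@algnormZ K A) (@algnorm0_eq0 K A).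

HB.mixin Record NormedAlgebra_isBanach (K : numFieldType) A
    of NormedAlgebra K A := {
  algnorm_complete : forall F : set_system (normed_space A),
    ProperFilter F -> cauchy F -> cvg F
}.

#[short(type="banachAlgType")]
HB.structure Definition BanachAlgebra (K : numFieldType) :=
  {A of NormedAlgebra K A & NormedAlgebra_isBanach K A}.

HB.instance Definition _ (K : numFieldType) (A : banachAlgType K) :=
  Uniform_isComplete.Build (normed_space A) (@algnorm_complete K A).

HB.mixin Record BanachAlgebra_isCstar (K : numClosedFieldType) A
    of BanachAlgebra K A := {
  star : A -> A;
  starK : involutive star;
  starD : {morph star : x y / x + y};
  starZ : forall (k : K) (x : A), star (k *: x) = k^* *: star x;
  starM : forall x y : A, star (x * y) = star y * star x;
  cstar_identity : forall x : A, algnorm (star x * x) = algnorm x ^+ 2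
}.

#[short(type="cstarAlgType")]
HB.structure Definition CstarAlgebra (K : numClosedFieldType) :=
  {A of BanachAlgebra K A & BanachAlgebra_isCstar K A}.

Section Rings.
Variable A : nzRingType.
Implicit Types (a b p q : A) (I J L M : set A).

(* In a unital algebra over K these are automatically K-subspaces, since
   k *: x = (k *: 1) * x = x * (k *: 1); they are additive subgroups since
   - x = (-1) * x. Ideals need not be proper. *)
Definition left_ideal I :=
  [/\ I 0, forall x y, I x -> I y -> I (x + y) & forall a x, I x -> I (a * x)].

Definition two_sided_ideal I :=
  left_ideal I /\ forall a x, I x -> I (x * a).

Definition minimal_left_ideal L :=
  [/\ left_ideal L, L <> [set 0] &
      forall J, left_ideal J -> J `<=` L -> J = [set 0] \/ J = L].

Definition maximal_left_ideal M :=
  [/\ left_ideal M, M <> setT &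
      forall J, left_ideal J -> M `<=` J -> J = M \/ J = setT].

Definition jacobson_radical : set A :=
  [set x | forall M, maximal_left_ideal M -> M x].

Definition semisimple := jacobson_radical = [set 0].

(* The empty sum makes the socle [set 0] when there is no minimal left ideal. *)
Definition socle : set A :=
  [set x | exists2 s : seq A,
     forall y, y \in s -> exists2 L, minimal_left_ideal L & L y
   & x = \sum_(y <- s) y].

Definition essential I :=
  [/\ two_sided_ideal I, I <> [set 0] &
      forall J, two_sided_ideal J -> J <> [set 0] -> I `&` J <> [set 0]].

Definition prime_ring :=
  forall I J, two_sided_ideal I -> two_sided_ideal J ->
    (forall x y, I x -> J y -> x * y = 0) -> I = [set 0] \/ J = [set 0].

Definition invertible a := exists b, a * b = 1 /\ b * a = 1.

Definition idempotents : set A := [set p | p * p = p].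

Definition ann_l a : set A := [set x | x * a = 0].
Definition ann_r a : set A := [set x | a * x = 0].

Definition minus_le a b :=
  exists p q, [/\ idempotents p, idempotents q,
    ann_l a = ann_l p, ann_r a = ann_r q & p * a = p * b /\ a * q = b * q].

End Rings.

Section Maps.
Variables (K : nzRingType) (A B : algType K).

Definition alg_isomorphism (Psi : A -> B) :=
  [/\ linear Psi, bijective Psi & {morph Psi : x y / x * y}].

Definition alg_antiisomorphism (Psi : A -> B) :=
  [/\ linear Psi, bijective Psi & forall x y, Psi (x * y) = Psi y * Psi x].

End Maps.

(* Main.v *)
(* An element [u] has rank at most one if [u a u] is a multiple of [u] for all
   [a]. In a semiprime algebra with enough such elements they are, together with
   [0], exactly the elements that are minimal for [<=^-]: below a nonzero [a] lies
   every [a u a] with [u a u = u]. Hence [Phi], which is bijective because [0] is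
   the only element below [0], preserves rank one in both directions.

   Let [e] be an idempotent of rank one. The elements of rank one of [A] are the
   products [x x'] of a column [x] in [A e] and a row [x'] in [e A], and similarly
   in [B]. Two elements of rank one whose sum has rank one share their column or
   their row; so, up to replacing [B] by its opposite algebra, [Phi] maps [A e]
   to columns and [e A] to rows, and [Phi (x x') = Phi x c Phi x'] with [c]
   inverse to [Phi e]. Comparing the elements of rank one below [a] and below
   [Phi a], for all perturbations of [a] by elements of rank one, shows that
   [Phi a] acts on columns as [h T a T^-1] with [h = Phi 1] and [T] a bijection
   of columns. Since [Phi] is onto, this forces [h] to be invertible in [B].

   Completeness and the C*-structure play no role in this argument: the norm only
   serves to obtain [e A e = C e] for minimal idempotents (Gelfand-Mazur). *)
Require Import Defs.
From HB Require Import structures.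
From mathcomp Require Import all_boot all_order all_algebra.
From mathcomp Require Import cyclic separable cyclotomic.
From mathcomp Require Import complex.
From mathcomp Require Import boolp classical_sets reals topology normedtype derive.

Set Implicit Arguments.
Unset Strict Implicit.
Unset Printing Implicit Defensive.

Import Order.TTheory GRing.Theory Num.Theory.
Import numFieldNormedType.Exports.

Local Open Scope classical_set_scope.
Local Open Scope ring_scope.

(** * Semiprime and prime rings by elements; first properties of the minus order *)

Section SemiprimeRings.
Variable A : nzRingType.
Implicit Types a b c p q u v x : A.

Lemma mulrA2 a b c : a * b = c -> forall x, x * a * b = x * c.
Proof. by move=> <- x; rewrite mulrA. Qed.

Lemma mulrA3 a b c p : a * b * c = p -> forall x, x * a * b * c = x * p.
Proof. by move=> <- x; rewrite !mulrA. Qed.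

Definition elt_semiprime := forall a, (forall x, a * x * a = 0) -> a = 0.
Definition elt_prime := forall a b, (forall x, a * x * b = 0) -> a = 0 \/ b = 0.

Lemma elt_prime_semiprime : elt_prime -> elt_semiprime.
Proof. by move=> pA a /pA[]. Qed.

Lemma elt_semiprimeP a : elt_semiprime -> a <> 0 -> exists x, a * x * a <> 0.
Proof.
move=> sA a0; apply: contrapT => nx; apply: a0; apply: sA => x.
by apply: contrapT => ax; apply: nx; exists x.
Qed.

Lemma elt_primeP a b : elt_prime -> a <> 0 -> b <> 0 -> exists x, a * x * b <> 0.
Proof.
move=> pA a0 b0; apply: contrapT => nx.
have [x||] := pA a b; last 2 first; [exact: a0|exact: b0|].
by apply: contrapT => ax; apply: nx; exists x.
Qed.

(** An outer inverse [u] of [a] makes [a * u] and [u * a] idempotent, and these have the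
    annihilators of [a * u * a]. *)
Lemma minus_le_inner a u : u * a * u = u -> minus_le (a * u * a) a.
Proof.
move=> uau; have uauA := mulrA3 uau; exists (a * u), (u * a); split.
- by rewrite /idempotents /= !mulrA uauA.
- by rewrite /idempotents /= !mulrA uau.
- apply/seteqP; split=> x; rewrite /ann_l /= !mulrA => x0.
    by rewrite -uauA x0 mul0r.
  by rewrite x0 mul0r.
- apply/seteqP; split=> x; rewrite /ann_r /= => x0.
    by rewrite -uau -!mulrA; move: x0; rewrite -!mulrA => ->; rewrite mulr0.
  by move: x0; rewrite -!mulrA => ->; rewrite mulr0.
- by split; rewrite !mulrA uauA.
Qed.

(** [1 - p] lies in [ann_l p = ann_l x] and [1 - q] in [ann_r q = ann_r x], so [p] and [q] fix
    [x]. *)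
Lemma minus_leE x a : minus_le x a -> exists p q, [/\ p * p = p, q * q = q,
  p * x = x, x * q = x & p * a = x /\ a * q = x].
Proof.
case=> p [q [pp qq xp xq [pa aq]]]; exists p, q.
have px : p * x = x.
  have : ann_l p (1 - p) by rewrite /ann_l /= mulrBl mul1r pp subrr.
  by rewrite -xp /ann_l /= mulrBl mul1r => /eqP; rewrite subr_eq0 => /eqP.
have qx : x * q = x.
  have : ann_r q (1 - q) by rewrite /ann_r /= mulrBr mulr1 qq subrr.
  by rewrite -xq /ann_r /= mulrBr mulr1 => /eqP; rewrite subr_eq0 => /eqP.
by split => //; split; rewrite -?pa -?aq.
Qed.

Lemma minus_le0 x : minus_le x 0 -> x = 0.
Proof. by move=> /minus_leE[p [q [_ _ _ _ [<-]]]]; rewrite mulr0. Qed.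

Lemma minus_le00 : minus_le 0 (0 : A).
Proof. by have := @minus_le_inner 0 0; rewrite !mul0r; apply. Qed.

End SemiprimeRings.

(** * Elements of rank at most one *)

Section RankOne.
Variables (F : fieldType) (A : algType F).
Implicit Types a b c p q r s t u v w x y z : A.

Definition rank_le1 u := forall a, exists k : F, u * a * u = k *: u.

(** By [minus_le_inner], [a * u * a] is then a nonzero rank-one element below [a]. *)
Definition enough_rank_one :=
  forall a, a <> 0 -> exists u, [/\ u <> 0, rank_le1 u & u * a * u = u].

Lemma rank_le1_mulr u b : rank_le1 u -> rank_le1 (u * b).
Proof.
move=> ru a; have [k kE] := ru (b * a); exists k.
by rewrite scalerAl -kE !mulrA.
Qed.

Lemma rank_le1_mull u b : rank_le1 u -> rank_le1 (b * u).
Proof.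
move=> ru a; have [k kE] := ru (a * b); exists k.
by rewrite scalerAr -kE !mulrA.
Qed.

Lemma rank_le1_regular u : elt_semiprime A -> rank_le1 u -> u <> 0 ->
  exists c, u * c * u = u /\ c * u * c = c.
Proof.
move=> sA ru u0; have [x xu] := elt_semiprimeP sA u0.
have [k kE] := ru x; have k0 : k != 0.
  by apply/eqP => k0; apply: xu; rewrite kE k0 scale0r.
pose d := k^-1 *: x.
have du : u * d * u = u.
  by rewrite /d -scalerAr -scalerAl kE scalerA mulVf // scale1r.
(* [d] is an inner inverse of [u]; [d * u * d] is both an inner and an outer one. *)
exists (d * u * d); split.
  by rewrite !mulrA du du.
by rewrite !mulrA !(mulrA3 du).
Qed.

(** [x = u * q] turns out to be a multiple [k *: u], and [p * x = x] then gives [k *: x = x]. *)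
Lemma rank_le1_minimal u x : elt_semiprime A -> rank_le1 u ->
  minus_le x u -> x = 0 \/ x = u.
Proof.
move=> sA ru /minus_leE [p [q [pp qq px xq [pu uq]]]].
have [u0|/eqP u0] := eqVneq u 0; first by left; rewrite -pu u0 mulr0.
have [c [uc _]] := rank_le1_regular sA ru u0.
have [k kE] := ru (q * c).
have xk : x = k *: u by rewrite -kE mulrA uq -pu (mulrA3 uc).
have : k *: x = x by rewrite -{1}pu scalerAr -xk.
have [->|/eqP x0] := eqVneq x 0; first by left.
move=> /eqP; rewrite -subr_eq0 -{2}(scale1r x) -scalerBl scaler_eq0.
case/orP=> [|/eqP//]; rewrite subr_eq0 => /eqP k1.
by right; rewrite xk k1 scale1r.
Qed.

Lemma minimal_rank_le1 a : enough_rank_one -> a <> 0 ->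
  (forall x, minus_le x a -> x = 0 \/ x = a) -> rank_le1 a.
Proof.
move=> eA a0 ma; have [u [u0 ru uau]] := eA _ a0.
have [aua0|<-] := ma _ (minus_le_inner uau).
  by case: u0; rewrite -uau -(mulrA3 uau) (mulrA3 aua0) mulr0 mul0r.
by apply: rank_le1_mulr; apply: rank_le1_mull.
Qed.

(** A converse to [minus_le_inner]: an inner and outer inverse [c] of [x] is cut down to
    [q * c * p], next to which [a] acts as [x]. *)
Lemma minus_le_rank_le1 x a : elt_semiprime A -> rank_le1 x -> minus_le x a ->
  exists u, u * a * u = u /\ a * u * a = x.
Proof.
move=> sA rx /minus_leE [p [q [pp qq px xq [pa aq]]]].
have [->|/eqP x0] := eqVneq x 0; first by exists 0; rewrite !mul0r mulr0 mul0r.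
have [c [xc cx]] := rank_le1_regular sA rx x0.
exists (q * c * p); split; last by rewrite -!mulrA pa !mulrA aq.
by rewrite !mulrA (mulrA2 pa) (mulrA2 xq) (mulrA3 cx).
Qed.

Hypothesis pA : elt_prime A.

(** Any nonzero [w] in [u * A] generates this right ideal, since primeness makes some [w * a * u] a
    nonzero multiple of [u]. *)
Lemma rank_le1_mem_right u v w r s : rank_le1 u -> w <> 0 ->
  w = u * r -> w = v * s -> exists t, u = v * t.
Proof.
move=> ru w0 wu wv.
have u0 : u <> 0 by move=> u0; apply: w0; rewrite wu u0 mul0r.
have [a wau] := elt_primeP pA w0 u0.
have [k kE] := ru (r * a); have k0 : k != 0.
  by apply/eqP => k0; apply: wau; rewrite wu -(mulrA u) kE k0 scale0r.
exists (k^-1 *: (s * a * u)); rewrite -scalerAr !mulrA -wv wu -(mulrA u) kE.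
by rewrite scalerA mulVf // scale1r.
Qed.

Lemma rank_le1_mem_left u v w r s : rank_le1 u -> w <> 0 ->
  w = r * u -> w = s * v -> exists t, u = t * v.
Proof.
move=> ru w0 wu wv.
have u0 : u <> 0 by move=> u0; apply: w0; rewrite wu u0 mulr0.
have [a uaw] := elt_primeP pA u0 w0.
have [k kE] := ru (a * r); have k0 : k != 0.
  by apply/eqP => k0; apply: uaw; rewrite wu mulrA -(mulrA u) kE k0 scale0r.
exists (k^-1 *: (u * a * s)); rewrite -scalerAl -!mulrA -wv wu !mulrA -(mulrA u) kE.
by rewrite scalerA mulVf // scale1r.
Qed.

(** If [v * d * v = v], then [u = s * v = u * d * v = v * (r * d) * v]. *)
Lemma rank_le1_parallel u v r s : rank_le1 v -> u = v * r -> u = s * v ->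
  exists k : F, u = k *: v.
Proof.
move=> rv uv1 uv2.
have [v0|/eqP v0] := eqVneq v 0; first by exists 0; rewrite uv1 v0 mul0r scaler0.
have [d [vd _]] := rank_le1_regular (elt_prime_semiprime pA) rv v0.
have [k kE] := rv (r * d); exists k; rewrite -kE mulrA -uv1 uv2.
by rewrite -!mulrA (mulrA v) vd.
Qed.

(* The elements of rank one are the [y * y'] with [y] a column and [y'] a row;
   a sum of two of them has rank at most one only if the columns or the rows
   are parallel. *)
Lemma rank_le1_add u v : rank_le1 u -> rank_le1 v -> rank_le1 (u + v) ->
  u <> 0 -> v <> 0 -> (exists t, v = u * t) \/ (exists t, v = t * u).
Proof.
move=> ru rv rw u0 v0.
have [c [uc _]] := rank_le1_regular (elt_prime_semiprime pA) ru u0.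
have [v10|/eqP v10] := eqVneq ((1 - u * c) * v) 0.
  left; exists (c * v); apply/eqP; rewrite -subr_eq0 mulrA -{1}(mul1r v) -mulrBl.
  exact/eqP.
have [v20|/eqP v20] := eqVneq (v * (1 - c * u)) 0.
  right; exists (v * c); apply/eqP; rewrite -subr_eq0 -mulrA -{1}(mulr1 v) -mulrBr.
  exact/eqP.
(* [1 - u * c] kills [u] from the left and [1 - c * u] from the right, but neither kills [v].
   Compressing [(u + v) * a * (u + v) = l *: (u + v)] on both sides gives [l = k]; compressing on
   the left only then gives [v1 * a * u = 0], against the choice of [a]. *)
exfalso.
have uL : (1 - u * c) * u = 0 by rewrite mulrBl mul1r uc subrr.
have uR : u * (1 - c * u) = 0 by rewrite mulrBr mulr1 mulrA uc subrr.
set v1 := _ * v in v10; set v2 := v * _ in v20.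
pose v12 := v1 * (1 - c * u).
have v1a a : exists k : F, v1 * a * v2 = k *: v12 /\ v1 * a * v = k *: v1.
  have [k kE] := rv a; exists k; split.
    by rewrite /v12 /v1 /v2 scalerAl scalerAr -kE !mulrA.
  by rewrite /v1 scalerAr -kE !mulrA.
have v12_0 : v12 <> 0.
  have [a] := elt_primeP pA v10 v20; have [k [-> _]] := v1a a.
  by move=> kv v120; apply: kv; rewrite v120 scaler0.
have wL : (1 - u * c) * (u + v) = v1 by rewrite mulrDr uL add0r.
have wR : (u + v) * (1 - c * u) = v2 by rewrite mulrDl uR add0r.
have [a v1u] := elt_primeP pA v10 u0.
have [k [k1 k2]] := v1a a; have [l lE] := rw a.
have lk : l = k.
  apply/eqP; rewrite -subr_eq0; apply/eqP; apply: contrapT => /eqP lk0.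
  apply: v12_0; apply/eqP; move/eqP: k1.
  rewrite -wR -wL mulrA -!(mulrA (1 - u * c)) !mulrA -(mulrA _ (u + v) a).
  rewrite -(mulrA _ _ (u + v)) lE -scalerAr wL -scalerAl -/v12 -subr_eq0 -scalerBl.
  by rewrite scaler_eq0 (negPf lk0).
apply: v1u; have : v1 * a * (u + v) = l *: v1.
  by rewrite -wL -!mulrA (mulrA (u + v)) lE scalerAr.
rewrite mulrDr k2 lk => /eqP; rewrite -subr_eq0 addrK => /eqP; exact.
Qed.

(** * Columns and rows of a rank-one idempotent *)

Section Corner.
Variable e : A.
Hypotheses (ee : e * e = e) (re : rank_le1 e) (e0 : e <> 0).

(** Rows times columns are multiples of [e]; primeness makes this pairing nondegenerate, and a
    nonzero value can be scaled to [e]. *)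
Lemma corner_left_dual x : x * e = x -> x <> 0 ->
  exists x', e * x' = x' /\ x' * x = e.
Proof.
move=> xe x0; have [a eax] := elt_primeP pA e0 x0.
have [k kE] := re (a * x); have k0 : k != 0.
  by apply/eqP => k0; apply: eax; rewrite -xe !mulrA -(mulrA e) kE k0 scale0r.
exists (k^-1 *: (e * a)); split; first by rewrite -scalerAr mulrA ee.
rewrite -scalerAl -xe !mulrA -(mulrA e) kE scalerA mulVf // scale1r //.
Qed.

Lemma corner_right_dual x : e * x = x -> x <> 0 ->
  exists x', x' * e = x' /\ x * x' = e.
Proof.
move=> ex x0; have [a xae] := elt_primeP pA x0 e0.
have [k kE] := re (x * a); have k0 : k != 0.
  by apply/eqP => k0; apply: xae; rewrite -ex -(mulrA e) kE k0 scale0r.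
exists (k^-1 *: (a * e)); split; first by rewrite -scalerAl -mulrA ee.
by rewrite -scalerAr -{1}ex !mulrA -(mulrA e) kE scalerA mulVf // scale1r.
Qed.

Lemma corner_mul_eq0 x x' : x * e = x -> e * x' = x' -> x * x' = 0 ->
  x = 0 \/ x' = 0.
Proof.
move=> xe ex' xx'; have [->|/eqP x'0] := eqVneq x' 0; first by right.
have [z [_ x'z]] := corner_right_dual ex' x'0.
by left; rewrite -xe -x'z mulrA xx' mul0r.
Qed.

(** Let [x'] be the dual row of a nonzero column [v * a * e]. Then [(v * a * e) * (x' * v)] is a
    multiple [k *: v], and [k = 0] would make [e = e * e] vanish. *)
Lemma rank_le1_factor v : rank_le1 v ->
  exists z z', [/\ z * e = z, e * z' = z' & v = z * z'].
Proof.
move=> rv; have [->|/eqP v0] := eqVneq v 0.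
  by exists 0, 0; rewrite !mul0r !mulr0.
have [a vae] := elt_primeP pA v0 e0.
have vaee : v * a * e * e = v * a * e by rewrite -mulrA ee.
have [x' [ex' x'v]] := corner_left_dual vaee vae.
have [k kE] := rv (a * e * x'); have k0 : k != 0.
  apply/eqP => k0; apply: e0.
  transitivity (x' * (v * a * e) * (x' * (v * a * e))); first by rewrite x'v ee.
  transitivity (x' * (v * (a * e * x') * v) * a * e); first by rewrite !mulrA.
  by rewrite kE k0 scale0r mulr0 !mul0r.
exists (k^-1 *: (v * a * e)), (x' * v); split.
- by rewrite -scalerAl vaee.
- by rewrite mulrA ex'.
- rewrite -scalerAl.
  have -> : v * a * e * (x' * v) = k *: v by rewrite -kE !mulrA.
  by rewrite scalerA mulVf // scale1r.
Qed.

End Corner.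
End RankOne.

(** If all [u * a * w] vanish, so do all [w * a * u] by semiprimeness, and
    [(u + w) * (c * u * c) * (u + w) = u]. Hence [u] is a multiple of [u + w], which forces
    [w = 0]. *)
Lemma rank_le1_connected (F : fieldType) (A : algType F) (u w : A) :
  elt_semiprime A -> rank_le1 u -> rank_le1 (u + w) -> u <> 0 -> w <> 0 ->
  exists a, u * a * w <> 0.
Proof.
move=> sA ru ruw u0 w0; apply: contrapT => nuaw.
have uaw a : u * a * w = 0 by apply: contrapT => h; apply: nuaw; exists a.
have wau a : w * a * u = 0.
  by apply: sA => b; rewrite !mulrA (mulrA3 (uaw b)) mulr0 !mul0r.
have [c [uc _]] := rank_le1_regular sA ru u0.
have [k kE] := ruw (c * u * c).
have ukw : u = k *: (u + w).
  by rewrite -kE !mulrDl !mulrDr !mulrA !uc !wau !mul0r !addr0 uaw addr0.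
have k0 : k <> 0 by move=> k0; apply: u0; rewrite ukw k0 scale0r.
have [x ux] := elt_semiprimeP sA u0; apply: ux.
have : u * x * u = k *: (u * x * u) + k *: (u * x * w).
  by rewrite -scalerDr -mulrDr scalerAr -ukw.
rewrite uaw scaler0 addr0 => /eqP; rewrite -subr_eq0 -{1}(scale1r (u * x * u)).
rewrite -scalerBl scaler_eq0 => /orP[|/eqP//]; rewrite subr_eq0 => /eqP k1.
case: w0; apply/eqP; move/eqP: ukw.
by rewrite -k1 scale1r -subr_eq0 opprD addrA subrr add0r oppr_eq0.
Qed.

(** * Linear maps preserving rank one in both directions *)

Section RankOnePreservers.
Variables (F : fieldType) (A B : algType F) (Phi : {linear A -> B}).
Hypothesis pB : elt_prime B.
Hypothesis Phi_inj : injective Phi.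
Hypothesis Phi_rank : forall a, rank_le1 a <-> rank_le1 (Phi a).

(** Rank-one outer inverses [u] of [a] and [v] of [b] would satisfy [u * x * v = 0] for all [x].
    Primeness of [B] yields a rank-one [w] whose sums with [u] and with [v] have rank one, so
    [rank_le1_connected] links [u] to [w] and [w] to [v]. As [w] has rank one, the links compose to
    a nonzero product from [u] to [v]. *)
Lemma rank_preserver_prime : elt_semiprime A -> enough_rank_one A ->
  (forall y, exists x, Phi x = y) -> elt_prime A.
Proof.
move=> sA eA Phi_surj a b ab.
have [->|/eqP a0] := eqVneq a 0; first by left.
have [->|/eqP b0] := eqVneq b 0; first by right.
have Phi0 x : x <> 0 -> Phi x <> 0.
  by move=> x0 Px; apply: x0; apply: Phi_inj; rewrite Px raddf0.
have [u [u0 ru uau]] := eA _ a0; have [v [v0 rv vbv]] := eA _ b0.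
have uv x : u * x * v = 0.
  transitivity (u * (a * (u * x * v) * b) * v); last by rewrite ab mulr0 mul0r.
  by rewrite !mulrA uau -{1}vbv !mulrA.
have /Phi_rank rPu := ru; have /Phi_rank rPv := rv.
have [t utv] := elt_primeP pB (Phi0 _ u0) (Phi0 _ v0).
have [w wE] := Phi_surj (Phi u * t * Phi v).
have w0 : w <> 0 by move=> w0; apply: utv; rewrite -wE w0 raddf0.
have rw : rank_le1 w by apply/Phi_rank; rewrite wE; exact: rank_le1_mull.
have ruw : rank_le1 (u + w).
  apply/Phi_rank; rewrite raddfD /= wE -mulrA -{1}(mulr1 (Phi u)) -mulrDr.
  exact: rank_le1_mulr.
have rwv : rank_le1 (w + v).
  apply/Phi_rank; rewrite raddfD /= wE -{2}(mul1r (Phi v)) -mulrDl.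
  exact: rank_le1_mull.
have [p up] := rank_le1_connected sA ru ruw u0 w0.
have [q wq] := rank_le1_connected sA rw rwv w0 v0.
have [s us] := elt_semiprimeP sA up.
have [k kE] := rw (s * u * p).
case: wq; have [k0|k0] := eqVneq k 0.
  case: us; transitivity (u * p * (w * (s * u * p) * w)); first by rewrite !mulrA.
  by rewrite kE k0 scale0r mulr0.
apply/eqP; have := scaler_eq0 k (w * q * v); rewrite (negPf k0) /= => <-.
rewrite !scalerAl -kE !mulrA.
have -> : w * s * u * p * w * q * v = w * s * (u * (p * w * q) * v) by rewrite !mulrA.
by rewrite uv mulr0.
Qed.

(** * Multiplicativity on products of a column and a row *)

Hypothesis pA : elt_prime A.
Variables (e : A) (c : B).
Hypotheses (ee : e * e = e) (re : rank_le1 e) (e0 : e <> 0).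
Hypothesis cec : c * Phi e * c = c.
Hypothesis Phi_col : forall x, x * e = x -> Phi x * c * Phi e = Phi x.
Hypothesis Phi_row : forall x, e * x = x -> Phi e * c * Phi x = Phi x.

Let rPe : rank_le1 (Phi e) := (Phi_rank e).1 re.

Let Phi_neq0 x : x <> 0 -> Phi x <> 0.
Proof. by move=> x0 Px; apply: x0; apply: Phi_inj; rewrite Px raddf0. Qed.

Lemma rank_preserver_col_parallel x t : x * e = x -> Phi x = Phi e * t ->
  exists k : F, x = k *: e.
Proof.
move=> xe xt; have [k kE] := rank_le1_parallel pB rPe xt (esym (Phi_col xe)).
by exists k; apply: Phi_inj; rewrite linearZ.
Qed.

Lemma rank_preserver_row_parallel x t : e * x = x -> Phi x = t * Phi e ->
  exists k : F, x = k *: e.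
Proof.
move=> ex xt; have := esym (Phi_row ex); rewrite -mulrA => xt'.
have [k kE] := rank_le1_parallel pB rPe xt' xt.
by exists k; apply: Phi_inj; rewrite linearZ.
Qed.

(* Adjacency confines [Phi (x * x')] to the multiples of [Phi x * c * Phi x'];
   the scalar is found by comparing with [Phi ((e + x) * x')]. *)
Lemma rank_preserver_mul x x' : x * e = x -> e * x' = x' ->
  Phi (x * x') = Phi x * c * Phi x'.
Proof.
move=> xe ex'.
have [[k ->]|nx] := pselect (exists k : F, x = k *: e).
  by rewrite -scalerAl ex' !linearZ /= -!scalerAl Phi_row.
have [[k ->]|nx'] := pselect (exists k : F, x' = k *: e).
  by rewrite -scalerAr xe !linearZ /= -!scalerAr Phi_col.
have x0 : x <> 0 by move=> x0; apply: nx; exists 0; rewrite scale0r.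
have x'0 : x' <> 0 by move=> x'0; apply: nx'; exists 0; rewrite scale0r.
have rx : rank_le1 x by rewrite -xe; exact: rank_le1_mull.
have rx' : rank_le1 x' by rewrite -ex'; exact: rank_le1_mulr.
have xx'0 : x * x' <> 0.
  by move/(corner_mul_eq0 pA ee re e0 xe ex') => [].
have rPx := (Phi_rank _).1 rx; have rPx' := (Phi_rank _).1 rx'.
have rPxx' : rank_le1 (Phi (x * x')) by apply/Phi_rank/rank_le1_mulr.
have exx' : (e + x) * x' <> 0.
  move/(corner_mul_eq0 pA ee re e0 _ ex'); case; first by rewrite mulrDl ee xe.
    move=> /eqP; rewrite addrC addr_eq0 => /eqP xE; apply: nx; exists (-1).
    by rewrite scaleN1r.
  by [].
(* The alternative [t * Phi x] is a left multiple of [Phi e]. Adjacency with [Phi x'] would then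
   make [x * x'], and with it [x], or else [x'] a multiple of [e]. *)
have [t tE] : exists t, Phi (x * x') = Phi x * t.
  have [|//|[t tE]] := rank_le1_add pB rPx rPxx' _ (Phi_neq0 x0) (Phi_neq0 xx'0).
    rewrite -raddfD /= -{1}xe -mulrDr; exact/Phi_rank/rank_le1_mulr.
  have tE' : Phi (x * x') = (t * Phi x * c) * Phi e.
    by rewrite tE -{1}(Phi_col xe) !mulrA.
  have [|[s sE]|[s sE]] := rank_le1_add pB rPx' rPxx' _ (Phi_neq0 x'0) (Phi_neq0 xx'0).
  - rewrite -raddfD /= -{1}ex' -mulrDl; exact/Phi_rank/rank_le1_mull.
  - exfalso; have sE' : Phi (x * x') = Phi e * (c * Phi x' * s).
      by rewrite sE -{1}(Phi_row ex') !mulrA.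
    have [k kE] := rank_le1_parallel pB rPe sE' tE'.
    have {}kE : x * x' = k *: e by apply: Phi_inj; rewrite linearZ.
    have [l lE] := re x'; have := congr1 (fun z => z * e) kE.
    rewrite -scalerAl ee -kE -mulrA -{1}ex' lE -scalerAr xe kE.
    have [->|l0] := eqVneq l 0.
      by rewrite scale0r => /esym k0; apply: xx'0; rewrite kE.
    move=> lx; apply: nx; exists (l^-1 * k); rewrite -scalerA -lx scalerA.
    by rewrite mulVf // scale1r.
  - exfalso.
    have [r rE] := rank_le1_mem_left pB rPx' (Phi_neq0 xx'0) sE tE'.
    exact: nx' (rank_preserver_row_parallel ex' rE).
have [s sE] : exists s, Phi (x * x') = s * Phi x'.
  have [|[s sE]|//] := rank_le1_add pB rPx' rPxx' _ (Phi_neq0 x'0) (Phi_neq0 xx'0).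
    rewrite -raddfD /= -{1}ex' -mulrDl; exact/Phi_rank/rank_le1_mull.
  have sE' : Phi (x * x') = Phi e * (c * Phi x' * s).
    by rewrite sE -{1}(Phi_row ex') !mulrA.
  have [r rE] := rank_le1_mem_right pB rPx (Phi_neq0 xx'0) tE sE'.
  by case: nx; exact: (rank_preserver_col_parallel xe rE).
have [k kE] : exists k : F, Phi (x * x') = k *: (Phi x * c * Phi x').
  have sB := elt_prime_semiprime pB.
  have [g [gE _]] := rank_le1_regular sB rPx' (Phi_neq0 x'0).
  have [k kE] := rPe (t * g); exists k.
  have -> : Phi (x * x') = Phi x * t * g * Phi x'.
    by rewrite -tE sE (mulrA3 gE).
  rewrite -{1}(Phi_col xe) -{1}(Phi_row ex').
  transitivity (Phi x * c * (Phi e * (t * g) * Phi e) * c * Phi x').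
    by rewrite !mulrA.
  by rewrite kE -scalerAr -!scalerAl Phi_col.
(* If [Phi ((e + x) * x')] shares its column with [Phi (e + x)], then [e + k *: x] is a multiple of
   [e + x], so [k = 1]. If it shares its row, [x'] is a multiple of [e]. *)
suff k1 : k = 1 by rewrite kE k1 scale1r.
have Px1 : Phi ((e + x) * x') = Phi (e + k *: x) * (c * Phi x').
  rewrite mulrDl ex' !raddfD /= linearZ /= mulrDl !mulrA Phi_row // kE.
  by rewrite scalerAl scalerAl.
have rekx : rank_le1 (e + k *: x).
  by rewrite -ee -xe scalerAl -mulrDl; exact: rank_le1_mull.
have rex : rank_le1 (e + x).
  by rewrite -ee -xe -mulrDl; exact: rank_le1_mull.
have exe : (e + x) * e = e + x by rewrite mulrDl ee xe.
have ex0 : e + x <> 0 by move=> ex0; apply: exx'; rewrite ex0 mul0r.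
have rPex := (Phi_rank _).1 rex.
have [||[s' s'E]|[s' s'E]] :=
    rank_le1_add pB rPex _ _ (Phi_neq0 ex0) (Phi_neq0 exx').
- exact/Phi_rank/rank_le1_mulr.
- rewrite -raddfD /= -{1}exe -mulrDr; exact/Phi_rank/rank_le1_mulr.
- have [r rE] := rank_le1_mem_right pB ((Phi_rank _).1 rekx) (Phi_neq0 exx') Px1 s'E.
  have [l lE] := rPe (r * c).
  have ekxe : (e + k *: x) * e = e + k *: x by rewrite mulrDl ee -scalerAl xe.
  have : e + k *: x = l *: (e + x).
    apply: Phi_inj; rewrite linearZ -(Phi_col ekxe) rE -{1}(Phi_col exe).
    transitivity (Phi (e + x) * c * (Phi e * (r * c) * Phi e)).
      by rewrite !mulrA.
    by rewrite lE -scalerAr Phi_col.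
  rewrite scalerDr => /eqP; rewrite -subr_eq0 opprD addrACA -scalerBl.
  rewrite -{1}(scale1r e) -scalerBl addr_eq0 -scaleNr opprB => /eqP elk.
  have [kl|kl] := eqVneq l k.
    move: elk; rewrite kl subrr scale0r => /eqP; rewrite scaler_eq0 subr_eq0.
    by case/orP=> [/eqP//|/eqP /e0].
  case: nx; exists ((l - k)^-1 * (1 - l)); rewrite -scalerA elk scalerA.
  by rewrite mulVf ?subr_eq0 // scale1r.
- have s2 : Phi ((e + x) * x') = (s' * Phi (e + x) * c) * Phi e.
    by rewrite s'E -{1}(Phi_col exe) !mulrA.
  rewrite mulrA in Px1.
  have [r rE] := rank_le1_mem_left pB rPx' (Phi_neq0 exx') Px1 s2.
  by case: nx'; exact: (rank_preserver_row_parallel ex' rE).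
Qed.

(** * The action of [Phi a] on columns, and invertibility of [Phi 1] *)

Hypothesis Phi_surj : forall y, exists x, Phi x = y.
Hypothesis Phi_minus_le : forall a b, minus_le a b -> minus_le (Phi a) (Phi b).

(** The idempotent of [B] that matches [e]: [Phi] sends a column [x] to a column of [f], and a row
    [x'] gives the row [c * Phi x'] of [f]. *)
Let f := c * Phi e.
Let h := Phi 1.

Let ff : f * f = f. Proof. by rewrite /f !mulrA cec. Qed.

Let rf : rank_le1 f. Proof. exact: rank_le1_mull. Qed.

Let Phi_mulf x : x * e = x -> Phi x * f = Phi x.
Proof. by move=> xe; rewrite /f mulrA Phi_col. Qed.

Let f0 : f <> 0.
Proof.
by move=> f0; apply: (Phi_neq0 e0); rewrite -(Phi_mulf ee) f0 mulr0.
Qed.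

Let mulf_Phi x : e * x = x -> f * (c * Phi x) = c * Phi x.
Proof. by move=> ex; rewrite /f -mulrA (mulrA (Phi e)) Phi_row. Qed.

Let Phi_mulS x x' : x * e = x -> e * x' = x' ->
  Phi (x * x') = Phi x * (c * Phi x').
Proof. by move=> xe ex'; rewrite rank_preserver_mul // mulrA. Qed.

(** A preimage of [y] factors as [z * z']; in [y = y * f] the row coming from [z'] is absorbed into
    a scalar. *)
Lemma rank_preserver_col_surj y : y * f = y -> exists x, x * e = x /\ Phi x = y.
Proof.
move=> yf; have [v vE] := Phi_surj y.
have rv : rank_le1 v by apply/Phi_rank; rewrite vE -yf; exact: rank_le1_mull.
have [z [z' [ze ez' vzz']]] := rank_le1_factor pA ee re e0 rv.
have [k kE] := rPe (c * Phi z' * c); exists (k *: z).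
split; first by rewrite -scalerAl ze.
rewrite linearZ /= -yf -vE vzz' Phi_mulS // -{2}(Phi_mulf ze) -{1}(Phi_mulf ze) /f.
transitivity (Phi z * c * (Phi e * (c * Phi z' * c) * Phi e)).
  by rewrite kE -scalerAr mulrA.
by rewrite !mulrA ?Phi_col.
Qed.

Lemma rank_preserver_row_surj y : f * y = y ->
  exists x, e * x = x /\ c * Phi x = y.
Proof.
move=> fy; have [v vE] := Phi_surj (Phi e * y).
have rv : rank_le1 v by apply/Phi_rank; rewrite vE; exact: rank_le1_mulr.
have [z [z' [ze ez' vzz']]] := rank_le1_factor pA ee re e0 rv.
have [k kE] := rPe (c * Phi z * c); exists (k *: z').
split; first by rewrite -scalerAr ez'.
rewrite linearZ /= -fy /f -mulrA -vE vzz' Phi_mulS // -(mulf_Phi ez') /f.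
transitivity (c * (Phi e * (c * Phi z * c) * Phi e) * (c * Phi z')).
  by rewrite kE -!scalerAr -scalerAl -/f mulf_Phi.
by rewrite !mulrA cec.
Qed.

(** [x * x'] is an outer inverse of [a], so [(a * x) * (x' * a)] is below [a] and its image is below
    [Phi a]. The outer inverse [v] of [Phi a] obtained from this is split into [y] and [y'] by the
    duals of [c * Phi (x' * a)] and of [Phi (a * x)]. *)
Lemma minus_le_preserver_witness a x x' :
  x * e = x -> e * x' = x' -> x' * a * x = e ->
  exists y y', [/\ y * f = y, Phi a * y = Phi (a * x),
    y' * Phi a = c * Phi (x' * a) & y' * Phi a * y = f].
Proof.
move=> xe ex' x'ax.
have uau : x * x' * a * (x * x') = x * x'.
  by rewrite !mulrA -(mulrA x) -(mulrA x (x' * a)) x'ax xe.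
have axe : a * x * e = a * x by rewrite -mulrA xe.
have ex'a : e * (x' * a) = x' * a by rewrite mulrA ex'.
have := Phi_minus_le (minus_le_inner uau); rewrite !mulrA -(mulrA _ x' a).
have rax : rank_le1 (Phi (a * x * (x' * a))).
  by apply/Phi_rank/rank_le1_mulr; rewrite -axe; exact: rank_le1_mull.
move=> /(minus_le_rank_le1 (elt_prime_semiprime pB) rax)[v [vbv bvb]].
rewrite (Phi_mulS axe ex'a) in bvb.
have ax0 : a * x <> 0 by move=> ax0; apply: e0; rewrite -x'ax -mulrA ax0 mulr0.
have x'a0 : x' * a <> 0 by move=> x'a0; apply: e0; rewrite -x'ax x'a0 mul0r.
have s0 : c * Phi (x' * a) <> 0.
  by move=> s0; apply: (Phi_neq0 x'a0); rewrite -(Phi_row ex'a) -mulrA s0 mulr0.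
have [r' [fr' r't]] := corner_left_dual pB ff rf f0 (Phi_mulf axe) (Phi_neq0 ax0).
have [r [rf' sr]] := corner_right_dual pB ff rf f0 (mulf_Phi ex'a) s0.
exists (v * Phi a * r), (r' * Phi a * v); split.
- by rewrite -!mulrA rf'.
- by rewrite !mulrA bvb -mulrA sr Phi_mulf.
- by rewrite -!mulrA (mulrA (Phi a)) bvb mulrA r't mulf_Phi.
- rewrite !mulrA (mulrA3 vbv) -(mulrA r') -(mulrA r') bvb mulrA r't -mulrA sr.
  exact: ff.
Qed.

(** The witnesses for [a = 1] write every row [c * Phi x'] with [x'] nonzero as [y' * h], and one of
    these rows would be dual to a nonzero [y]. *)
Lemma minus_le_preserver_one_inj y : y * f = y -> h * y = 0 -> y = 0.
Proof.
move=> yf hy; have [//|/eqP y0] := eqVneq y 0.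
have [s [fs sy]] := corner_left_dual pB ff rf f0 yf y0.
have [x' [ex' sE]] := rank_preserver_row_surj fs.
have x'0 : x' <> 0.
  by move=> x'0; apply: f0; rewrite -sy -sE x'0 raddf0 mulr0 mul0r.
have [x [xe x'x]] := corner_right_dual pA ee re e0 ex' x'0.
have x'1x : x' * 1 * x = e by rewrite mulr1.
have [_ [y' [_ _ y'h _]]] := minus_le_preserver_witness xe ex' x'1x.
by case: f0; rewrite -sy -sE -{1}(mulr1 x') -y'h -mulrA hy mulr0.
Qed.

Lemma minus_le_preserver_one_surj x : exists y, y * f = y /\ h * y = Phi (x * e).
Proof.
have xee : x * e * e = x * e by rewrite -mulrA ee.
have [->|/eqP x0] := eqVneq (x * e) 0; first by exists 0; rewrite raddf0 mul0r mulr0.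
have [x' [ex' x'x]] := corner_left_dual pA ee re e0 xee x0.
have x'1x : x' * 1 * (x * e) = e by rewrite mulr1.
have [y [_ [yf hy _ _]]] := minus_le_preserver_witness xee ex' x'1x.
by exists y; rewrite hy mul1r.
Qed.

(** Left multiplication by [h] is injective on columns of [B], so on columns [T] stands for
    [h^-1 * Phi] while [h] is not yet known to be invertible. *)
Variable T : A -> B.
Hypothesis TP : forall x, T x * f = T x /\ h * T x = Phi (x * e).

Let Tf x : T x * f = T x. Proof. by case: (TP x). Qed.

Let hT x : x * e = x -> h * T x = Phi x.
Proof. by move=> xe; case: (TP x); rewrite xe. Qed.

Let T_unique x y : x * e = x -> y * f = y -> h * y = Phi x -> y = T x.
Proof.
move=> xe yf hy; apply/eqP; rewrite -subr_eq0; apply/eqP.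
by apply: minus_le_preserver_one_inj; rewrite ?mulrBl ?yf ?Tf // mulrBr hy hT ?subrr.
Qed.

Let T0 : T 0 = 0.
Proof. by symmetry; apply: T_unique; rewrite ?mul0r ?mulr0 ?raddf0. Qed.

Let T_inj x z : x * e = x -> z * e = z -> T x = T z -> x = z.
Proof. by move=> xe ze Txz; apply: Phi_inj; rewrite -hT // Txz hT. Qed.

(** For [k = 1] these are the witnesses for [a = 1], where [y] must be [T x]. Scaling settles
    nonzero [k]; for [k = 0], compare [x' + z] with [z], where [z * x = e]. *)
Lemma minus_le_preserver_pairing x x' (k : F) :
  x * e = x -> e * x' = x' -> x' * x = k *: e -> c * Phi x' * T x = k *: f.
Proof.
move=> xe.
have pair1 z : e * z = z -> z * x = e -> c * Phi z * T x = f.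
  move=> ez zx; have z1x : z * 1 * x = e by rewrite mulr1.
  have [y [y' [yf hy y'h y'hy]]] := minus_le_preserver_witness xe ez z1x.
  rewrite mul1r in hy; rewrite mulr1 in y'h.
  by rewrite -(T_unique xe yf hy) -y'h.
move=> ex' x'x.
have [k0|k0] := eqVneq k 0; last first.
  have <- : c * Phi (k^-1 *: x') * T x = f.
    by apply: pair1; rewrite -?scalerAr ?ex' // -scalerAl x'x scalerA mulVf ?scale1r.
  by rewrite linearZ /= -scalerAr -scalerAl scalerA mulfV // scale1r.
rewrite k0 scale0r in x'x; rewrite k0 scale0r.
have [->|/eqP x0] := eqVneq x 0; first by rewrite T0 mulr0.
have [z [ez zx]] := corner_left_dual pA ee re e0 xe x0.
have : c * Phi (x' + z) * T x = f.
  by apply: pair1; [rewrite mulrDr ex' ez|rewrite mulrDl x'x zx add0r].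
rewrite raddfD /= mulrDr mulrDl (pair1 z) // => /eqP.
by rewrite -subr_eq0 addrK => /eqP.
Qed.

(* If [Phi a * T x] were a nonzero column [Phi z], then the perturbation
   [a + z * z'] with [z' * x = e] would map [x] to [z], and the rows witnessing
   this would contradict [a * x = 0]. *)
Let Phi_kernel a x : x * e = x -> a * x = 0 -> Phi a * T x = 0.
Proof.
move=> xe ax; apply: contrapT => aT0.
have aTf : Phi a * T x * f = Phi a * T x by rewrite -mulrA Tf.
have [z [ze zE]] := rank_preserver_col_surj aTf.
have z0 : z <> 0 by move=> z0; apply: aT0; rewrite -zE z0 raddf0.
have x0 : x <> 0 by move=> x0; apply: aT0; rewrite x0 T0 mulr0.
have [x' [ex' x'z]] := corner_left_dual pA ee re e0 ze z0.
have [z' [ez' z'x]] := corner_left_dual pA ee re e0 xe x0.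
have zz'x : (a + z * z') * x = z by rewrite mulrDl ax add0r -mulrA z'x.
have x'zz' : x' * (a + z * z') = x' * a + z' by rewrite mulrDr mulrA x'z ez'.
have x'x : x' * (a + z * z') * x = e by rewrite -mulrA zz'x.
have [y [y' [yf Py y'P y'Py]]] := minus_le_preserver_witness xe ex' x'x.
have y'z : y' * Phi z = f by rewrite -y'Py -mulrA Py zz'x.
have y'a : y' * Phi a = c * Phi (x' * a).
  move: y'P; rewrite x'zz' !raddfD /= Phi_mulS // mulrDr mulrA y'z mulf_Phi //.
  by rewrite mulrDr => /addIr.
apply: f0; rewrite -y'z zE mulrA y'a -(scale0r f).
apply: minus_le_preserver_pairing; rewrite // ?mulrA ?ex' //.
by rewrite -mulrA ax mulr0 scale0r.
Qed.

(** With [z * x = e], [a - a * x * z] kills [x] and [Phi_kernel] applies to it; on [a * x * z] the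
    pairing computes the action. *)
Lemma minus_le_preserver_intertwine a x : x * e = x ->
  Phi a * T x = h * T (a * x).
Proof.
move=> xe; have axe : a * x * e = a * x by rewrite -mulrA xe.
rewrite hT //.
have [->|/eqP x0] := eqVneq x 0; first by rewrite T0 !mulr0 raddf0.
have [z [ez zx]] := corner_left_dual pA ee re e0 xe x0.
have := @Phi_kernel (a - a * x * z) x xe.
rewrite mulrBl -(mulrA _ z) zx axe subrr raddfB /= mulrBl Phi_mulS // -mulrA.
rewrite (@minus_le_preserver_pairing _ _ 1) ?scale1r // Phi_mulf //.
by move=> /(_ erefl) /eqP; rewrite subr_eq0 => /eqP.
Qed.

Let eq_col a b : (forall x, x * e = x -> a * x = b * x) -> a = b.
Proof.
move=> ab; apply/eqP; rewrite -subr_eq0; apply/eqP.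
have [|//|/e0//] := @pA (a - b) e.
by move=> x; rewrite -mulrA mulrBl ab ?subrr // -mulrA ee.
Qed.

Let eq_colT (a b : B) : (forall x, x * e = x -> a * T x = b * T x) -> a = b.
Proof.
move=> ab; apply/eqP; rewrite -subr_eq0; apply/eqP.
have [|//|/f0//] := @pB (a - b) f.
move=> y; rewrite -mulrA mulrBl.
have yf : y * f * f = y * f by rewrite -mulrA ff.
have hyf : h * (y * f) * f = h * (y * f) by rewrite -mulrA yf.
have [x [xe /esym/(T_unique xe yf) ->]] := rank_preserver_col_surj hyf.
by rewrite ab ?subrr.
Qed.

(* [Phi a] acts on the columns of [B] as [h T a T^-1]. Hence [B = h A'] where
   [A' = T A T^-1] is a unital algebra of operators; as [1] and [h * h] belong to
   [h A'], both [h^-1] and [h] belong to [A'], so that [h^-1] is in [h A' = B]. *)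
Lemma minus_le_preserver_one_invertible : exists k : B,
  [/\ k * h = 1, h * k = 1 & forall a b, k * Phi (a * b) = k * Phi a * (k * Phi b)].
Proof.
have tw := minus_le_preserver_intertwine.
have mulAe a x : x * e = x -> a * x * e = a * x by move=> xe; rewrite -mulrA xe.
have [u uE] := Phi_surj 1; have [g gE] := Phi_surj (h * h).
have h_inj x z : x * e = x -> z * e = z -> h * T x = h * T z -> T x = T z.
  by move=> xe ze hxz; apply: T_unique; rewrite // hxz hT.
have uT x : x * e = x -> h * T (u * x) = T x by move=> xe; rewrite -tw // uE mul1r.
have gT x : x * e = x -> T (g * x) = h * T x.
  move=> xe; apply/eqP; rewrite -subr_eq0; apply/eqP.
  apply: minus_le_preserver_one_inj; first by rewrite mulrBl Tf -mulrA Tf.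
  by rewrite mulrBr -tw // gE mulrA subrr.
have gu : g * u = 1.
  apply: eq_col => x xe; rewrite mul1r -mulrA; apply: T_inj; rewrite ?mulAe //.
  by rewrite gT ?mulAe // uT.
have ug : u * g = 1.
  apply: eq_col => x xe; rewrite mul1r -mulrA; apply: T_inj; rewrite ?mulAe //.
  by apply: h_inj; rewrite ?mulAe // uT ?mulAe // gT.
(* [T u T^-1] inverts [h] on columns, so [Phi (u * u)] acts as [h T u u T^-1 = T u T^-1 = h^-1]. *)
have kT x : x * e = x -> Phi (u * u) * T x = T (u * x).
  by move=> xe; rewrite tw // -mulrA uT ?mulAe.
have kh : Phi (u * u) * h = 1.
  by apply: eq_colT => x xe; rewrite mul1r -mulrA -gT // kT ?mulAe // mulrA ug mul1r.
exists (Phi (u * u)); split => //.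
  by apply: eq_colT => x xe; rewrite mul1r -mulrA kT // uT.
have kPT a x : x * e = x -> Phi (u * u) * Phi a * T x = T (a * x).
  by move=> xe; rewrite -mulrA tw // mulrA kh mul1r.
move=> a b; apply: eq_colT => x xe.
by rewrite kPT // -(mulrA _ _ (T x)) !kPT ?mulAe // mulrA.
Qed.

End RankOnePreservers.

(** * Opposite algebras, which turn anti-isomorphisms into isomorphisms *)

Definition opposite (F : fieldType) (A : algType F) : Type := A^c.

HB.instance Definition _ (F : fieldType) (A : algType F) :=
  GRing.NzRing.copy (opposite A) A^c.
HB.instance Definition _ (F : fieldType) (A : algType F) :=
  GRing.Zmodule_isLmodule.Build F (opposite A) (@scalerA F A) (@scale1r F A)
    (@scalerDr F A) (fun v x y => scalerDl v x y).

Lemma opposite_scalerAl (F : fieldType) (A : algType F) (k : F) (x y : opposite A) :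
  k *: (x * y) = k *: x * y.
Proof. exact: (@scalerAr F A k y x). Qed.

Lemma opposite_scalerAr (F : fieldType) (A : algType F) (k : F) (x y : opposite A) :
  k *: (x * y) = x * (k *: y).
Proof. exact: (@scalerAl F A k y x). Qed.

HB.instance Definition _ (F : fieldType) (A : algType F) :=
  GRing.Lmodule_isLalgebra.Build F (opposite A) (@opposite_scalerAl F A).
HB.instance Definition _ (F : fieldType) (A : algType F) :=
  GRing.Lalgebra_isAlgebra.Build F (opposite A) (@opposite_scalerAr F A).

Section Opposite.
Variables (F : fieldType) (A : algType F).

Lemma elt_prime_opposite : elt_prime A -> elt_prime (opposite A).
Proof.
move=> pA a b ab; have [x|->|->] := @pA b a; [|by right|by left].
by rewrite -mulrA; exact: ab.
Qed.

Lemma rank_le1_opposite (u : A) : rank_le1 u <-> rank_le1 (u : opposite A).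
Proof.
by split=> ru a; have [k kE] := ru a; exists k;
  [exact: etrans (mulrA u a u) kE|exact: etrans (esym (mulrA u a u)) kE].
Qed.

Lemma minus_le_opposite (a b : A) :
  minus_le a b <-> minus_le (a : opposite A) (b : opposite A).
Proof.
by split=> -[p [q [pp qq ap aq [pa qa]]]]; exists q, p; split.
Qed.

End Opposite.

Definition to_opposite (F : fieldType) (A B : algType F) (Phi : A -> B) :
  A -> opposite B := Phi.

HB.instance Definition _ (F : fieldType) (A B : algType F) (Phi : {linear A -> B}) :=
  GRing.isLinear.Build F A (opposite B) *:%R (to_opposite Phi) (linearP Phi).

Lemma inj_surj_bijective (S U : Type) (g : S -> U) :
  injective g -> (forall y, exists x, g x = y) -> bijective g.
Proof.
move=> g_inj /choice[g' g'K]; exists g' => // x.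
exact: g_inj.
Qed.

(** If [x] escapes [P] and [y] escapes [Q], then [x + y] escapes both. *)
Lemma union_of_subgroups (V : zmodType) (W P Q : V -> Prop) :
  (forall x y, W x -> W y -> W (x + y)) ->
  (forall x y, P x -> P y -> P (x - y)) -> (forall x y, Q x -> Q y -> Q (x - y)) ->
  (forall x, W x -> P x \/ Q x) ->
  (forall x, W x -> P x) \/ (forall x, W x -> Q x).
Proof.
move=> WD PB QB PQ; apply: contrapT => /not_orP[/existsNP[x /not_implyP[Wx nPx]]].
move=> /existsNP[y /not_implyP[Wy nQy]].
have Py : P y by case: (PQ y Wy).
have Qx : Q x by case: (PQ x Wx).
case: (PQ _ (WD _ _ Wx Wy)) => [Pxy|Qxy].
  by apply: nPx; rewrite -(addrK y x); exact: PB.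
by apply: nQy; rewrite -(addrK x y) (addrC y); exact: QB.
Qed.

(** * The dichotomy between isomorphisms and anti-isomorphisms *)

Section MinusOrderPreservers.
Variable F : fieldType.
Implicit Types A B : algType F.

Lemma minus_le_preserver_isomorphism A B (Phi : {linear A -> B}) (e : A) :
  elt_prime A -> elt_prime B -> injective Phi -> (forall y, exists x, Phi x = y) ->
  (forall a, rank_le1 a <-> rank_le1 (Phi a)) ->
  (forall a b, minus_le a b -> minus_le (Phi a) (Phi b)) ->
  e * e = e -> rank_le1 e -> e <> 0 ->
  (forall x, x * e = x -> exists t, Phi x = t * Phi e) ->
  (forall x, e * x = x -> exists t, Phi x = Phi e * t) ->
  exists c (Psi : A -> B), [/\ invertible c, alg_isomorphism Psi &
    forall x, Phi x = c * Psi x].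
Proof.
move=> pA pB Phi_inj Phi_surj Phi_rank Phi_le ee re e0 Phi_col Phi_row.
have Pe0 : Phi e <> 0 by move=> Pe0; apply: e0; apply: Phi_inj; rewrite Pe0 raddf0.
have [c [ece cec]] :=
  rank_le1_regular (elt_prime_semiprime pB) ((Phi_rank e).1 re) Pe0.
have col x : x * e = x -> Phi x * c * Phi e = Phi x.
  by move=> /Phi_col[t ->]; rewrite !(mulrA3 ece).
have row x : e * x = x -> Phi e * c * Phi x = Phi x.
  by move=> /Phi_row[t ->]; rewrite !mulrA ece.
have [T TP] := choice (minus_le_preserver_one_surj
  pB Phi_inj Phi_rank pA ee re e0 cec col row Phi_le).
have [k [kh hk km]] := minus_le_preserver_one_invertible
  pB Phi_inj Phi_rank pA ee re e0 cec col row Phi_surj Phi_le TP.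
exists (Phi 1), (fun x => k * Phi x); split; first by exists k.
  split.
  - by move=> l x y; rewrite linearP mulrDr scalerAr.
  - apply: inj_surj_bijective => [x y kxy|y].
      by apply: Phi_inj; rewrite -(mul1r (Phi x)) -hk -mulrA kxy mulrA hk mul1r.
    by have [x xE] := Phi_surj (Phi 1 * y); exists x; rewrite xE mulrA kh mul1r.
  - exact: km.
by move=> x; rewrite mulrA hk mul1r.
Qed.

Section Preserver.
Variables (A B : algType F) (Phi : {linear A -> B}).
Hypotheses (sA : elt_semiprime A) (eA : enough_rank_one A).
Hypotheses (pB : elt_prime B) (eB : enough_rank_one B).
Hypothesis Phi_surj : forall y, exists x, Phi x = y.
Hypothesis Phi_le : forall a b, minus_le a b <-> minus_le (Phi a) (Phi b).

Lemma minus_le_preserver_eq0 x : Phi x = 0 -> x = 0.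
Proof.
by move=> Px; apply: minus_le0; apply/Phi_le; rewrite Px raddf0; exact: minus_le00.
Qed.

Lemma minus_le_preserver_inj : injective Phi.
Proof.
move=> x y Pxy; apply/eqP; rewrite -subr_eq0; apply/eqP.
by apply: minus_le_preserver_eq0; rewrite raddfB /= Pxy subrr.
Qed.

Lemma minus_le_preserver_rank a : rank_le1 a <-> rank_le1 (Phi a).
Proof.
have [->|/eqP a0] := eqVneq a 0.
  by rewrite raddf0; split=> _ x; exists 0; rewrite !mul0r scaler0.
split=> ra.
  apply: minimal_rank_le1 eB _ _; first by move/minus_le_preserver_eq0.
  move=> y; have [x <-] := Phi_surj y => /Phi_le/(rank_le1_minimal sA ra)[->|->].
    by left; rewrite raddf0.
  by right.
apply: minimal_rank_le1 eA a0 _ => x /Phi_le.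
move=> /(rank_le1_minimal (elt_prime_semiprime pB) ra)[/minus_le_preserver_eq0|].
  by left.
by move/minus_le_preserver_inj; right.
Qed.

Let pA : elt_prime A :=
  rank_preserver_prime pB minus_le_preserver_inj minus_le_preserver_rank sA eA Phi_surj.

(** Suppose that neither the column [x] nor the row [y] is a multiple of [e]. If [x + y] has rank
    one, a shared column puts [x] in [e * A] and a shared row puts [y] in [A * e], which is
    absurd. *)
Lemma column_or_row_trivial (e : A) : e * e = e -> rank_le1 e ->
  (forall x y, x * e = x -> e * y = y -> rank_le1 (x + y)) ->
  (forall x, x * e = x -> exists k : F, x = k *: e) \/
  (forall y, e * y = y -> exists k : F, y = k *: e).
Proof.
move=> ee re rD; apply: contrapT => /not_orP[/existsNP[x /not_implyP[xe nx]]].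
move=> /existsNP[y /not_implyP[ey ny]].
have x0 : x <> 0 by move=> x0; apply: nx; exists 0; rewrite scale0r.
have y0 : y <> 0 by move=> y0; apply: ny; exists 0; rewrite scale0r.
have rx : rank_le1 x by rewrite -xe; exact: rank_le1_mull.
have ry : rank_le1 y by rewrite -ey; exact: rank_le1_mulr.
have [[t tE]|[t tE]] := rank_le1_add pA rx ry (rD _ _ xe ey) x0 y0.
  have [r rE] := rank_le1_mem_right pA rx y0 tE (esym ey).
  by case: nx; exact: (rank_le1_parallel pA re rE (esym xe)).
apply: ny; apply: (@rank_le1_parallel _ _ pA _ _ y (t * x) re (esym ey)).
by rewrite -mulrA xe.
Qed.

Theorem minus_le_preserver_iso_or_antiiso : exists c (Psi : A -> B),
  [/\ invertible c, alg_isomorphism Psi \/ alg_antiisomorphism Psi &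
    forall x, Phi x = c * Psi x].
Proof.
have one0 : (1 : A) <> 0 by apply/eqP; exact: oner_neq0.
have [e [e0 re]] := eA one0; rewrite mulr1 => ee.
pose b := Phi e.
have Phi_inj := minus_le_preserver_inj; have Phi_rank := minus_le_preserver_rank.
have b0 : b <> 0 by move/minus_le_preserver_eq0.
have rb : rank_le1 b by apply/Phi_rank.
pose inBb x := exists t, Phi x = t * b; pose inbB x := exists t, Phi x = b * t.
have PhiP x : rank_le1 x -> rank_le1 (e + x) -> inBb x \/ inbB x.
  move=> rx rex; have [->|/eqP x0] := eqVneq x 0.
    by left; exists 0; rewrite raddf0 mul0r.
  have [||||[t tE]|[t tE]] := @rank_le1_add _ _ pB b (Phi x) rb.
  - exact/Phi_rank.
  - by rewrite -raddfD; apply/Phi_rank.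
  - by [].
  - by move/minus_le_preserver_eq0.
  - by right; exists t.
  - by left; exists t.
have inBbB x y : inBb x -> inBb y -> inBb (x - y).
  by move=> [t tE] [s sE]; exists (t - s); rewrite raddfB /= tE sE mulrBl.
have inbBB x y : inbB x -> inbB y -> inbB (x - y).
  by move=> [t tE] [s sE]; exists (t - s); rewrite raddfB /= tE sE mulrBr.
have scalarP x : (exists k : F, x = k *: e) -> inBb x /\ inbB x.
  move=> [k ->]; split; exists k%:A; rewrite linearZ /=.
    by rewrite -scalerAl mul1r.
  by rewrite -scalerAr mulr1.
have rcol x : x * e = x -> rank_le1 x by move=> <-; exact: rank_le1_mull.
have rrow x : e * x = x -> rank_le1 x by move=> <-; exact: rank_le1_mulr.
have colP : (forall x, x * e = x -> inBb x) \/ (forall x, x * e = x -> inbB x).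
  apply: union_of_subgroups => // [x y xe ye|x xe]; first by rewrite mulrDl xe ye.
  by apply: PhiP; apply: rcol; rewrite // mulrDl ee xe.
have rowP : (forall x, e * x = x -> inBb x) \/ (forall x, e * x = x -> inbB x).
  apply: union_of_subgroups => // [x y xe ye|x xe]; first by rewrite mulrDr xe ye.
  by apply: PhiP; apply: rrow; rewrite // mulrDr ee xe.
have iso : (forall x, x * e = x -> inBb x) -> (forall x, e * x = x -> inbB x) ->
    exists c (Psi : A -> B), [/\ invertible c,
      alg_isomorphism Psi \/ alg_antiisomorphism Psi & forall x, Phi x = c * Psi x].
  move=> col row; have [|c [Psi [cinv iPsi PsiE]]] := @minus_le_preserver_isomorphism
    A B Phi e pA pB Phi_inj Phi_surj Phi_rank _ ee re e0 col row.
    by move=> x y /Phi_le.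
  by exists c, Psi; split => //; left.
have antiiso : (forall x, x * e = x -> inbB x) -> (forall x, e * x = x -> inBb x) ->
    exists c (Psi : A -> B), [/\ invertible c,
      alg_isomorphism Psi \/ alg_antiisomorphism Psi & forall x, Phi x = c * Psi x].
  move=> col row.
  have [||c [Psi [[d [cd dc]] [lPsi [Psi' PsiK Psi'K] mPsi] PsiE]]] :=
    @minus_le_preserver_isomorphism A (opposite B) (to_opposite Phi) e pA
      (elt_prime_opposite pB) Phi_inj Phi_surj _ _ ee re e0 col row.
  - by move=> x; rewrite Phi_rank; exact: rank_le1_opposite.
  - by move=> x y /Phi_le; rewrite -minus_le_opposite.
  pose c' : B := c; pose d' : B := d.
  have cd' : c' * d' = 1 := dc; have dc' : d' * c' = 1 := cd.
  (* In [B] the factor stands on the right, [Phi x = Psi x * c']; conjugation by [c'] moves it to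
     the left. *)
  exists c', (fun x => d' * (Psi x : B) * c'); split; first by exists d'.
    right; split.
    - by move=> k x y; rewrite lPsi mulrDr mulrDl -scalerAr -scalerAl.
    - exists (fun y => Psi' (c' * y * d' : B)) => x.
        by rewrite -[RHS]PsiK; congr Psi'; rewrite !mulrA cd' mul1r -mulrA cd' mulr1.
      by rewrite Psi'K !mulrA dc' mul1r -mulrA dc' mulr1.
    - move=> x y; rewrite mPsi -!mulrA (mulrA c') cd' mul1r.
      by congr (_ * _); exact: (esym (mulrA (Psi y : B) (Psi x : B) c')).
  move=> x; rewrite !mulrA cd' mul1r; exact: PsiE.
(* When columns and rows go to the same side, all these sums have rank one. Then columns or rows are
   just multiples of [e], with images on both sides, which leads back to [iso] or [antiiso]. *)
have mixed : (forall x y, x * e = x -> e * y = y -> rank_le1 (x + y)) ->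
    (forall x, x * e = x -> inBb x /\ inbB x) \/
    (forall x, e * x = x -> inBb x /\ inbB x).
  by move/(column_or_row_trivial ee re) => [eP|eP]; [left|right] => x /eP/scalarP.
case: colP => colP; case: rowP => rowP; [|exact: iso|exact: antiiso|].
  case: mixed => [x y xe ey|cP|rP].
  - apply/Phi_rank; rewrite raddfD /=; have [t ->] := colP _ xe.
    by have [s ->] := rowP _ ey; rewrite -mulrDl; exact: rank_le1_mull.
  - by apply: antiiso => // x /cP[].
  - by apply: iso => // x /rP[].
case: mixed => [x y xe ey|cP|rP].
- apply/Phi_rank; rewrite raddfD /=; have [t ->] := colP _ xe.
  by have [s ->] := rowP _ ey; rewrite -mulrDr; exact: rank_le1_mulr.
- by apply: iso => // x /cP[].
- by apply: antiiso => // x /rP[].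
Qed.

End Preserver.
End MinusOrderPreservers.

(** * Maps under which the minus order is invariant *)

Section MinusOrderInvariance.

Lemma minus_le_morph (A B : nzRingType) (Psi : A -> B) (a b : A) :
  injective Psi -> (forall y, exists x, Psi x = y) -> Psi 0 = 0 ->
  {morph Psi : x y / x * y} -> minus_le a b -> minus_le (Psi a) (Psi b).
Proof.
move=> Psi_inj Psi_surj Psi0 PsiM [p [q [pp qq ap aq [pa qa]]]].
have Psi_eq0 x : Psi x = 0 <-> x = 0.
  by split=> [|->//]; rewrite -[in X in X -> _]Psi0 => /Psi_inj.
exists (Psi p), (Psi q); split.
- by rewrite /idempotents /= -PsiM pp.
- by rewrite /idempotents /= -PsiM qq.
- apply/seteqP; split=> y; have [x <-] := Psi_surj y;
    rewrite /ann_l /= -!PsiM !Psi_eq0 => xa.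
    by have : ann_l a x by []; rewrite ap.
  by have : ann_l p x by []; rewrite -ap.
- apply/seteqP; split=> y; have [x <-] := Psi_surj y;
    rewrite /ann_r /= -!PsiM !Psi_eq0 => xa.
    by have : ann_r a x by []; rewrite aq.
  by have : ann_r q x by []; rewrite -aq.
- by rewrite -!PsiM pa qa.
Qed.

Lemma minus_le_bij_morph (A B : nzRingType) (Psi : A -> B) (a b : A) :
  bijective Psi -> Psi 0 = 0 -> {morph Psi : x y / x * y} ->
  minus_le a b <-> minus_le (Psi a) (Psi b).
Proof.
move=> [g PsiK gK] Psi0 PsiM; split; last rewrite -{2}(PsiK a) -{2}(PsiK b).
  by apply: minus_le_morph => //; [exact: can_inj PsiK|move=> y; exists (g y)].
apply: minus_le_morph; [exact: can_inj gK|by move=> y; exists (Psi y)| |].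
  by rewrite -Psi0 PsiK.
by move=> x y; apply: (can_inj PsiK); rewrite PsiM !gK.
Qed.

Lemma minus_le_mull (A : nzRingType) (c d a b : A) : c * d = 1 -> d * c = 1 ->
  minus_le a b -> minus_le (c * a) (c * b).
Proof.
move=> cd dc [p [q [pp qq ap aq [pa qa]]]].
have cancel x : c * x = 0 <-> x = 0.
  by split=> [cx|->]; rewrite ?mulr0 // -(mul1r x) -dc -mulrA cx mulr0.
have cancelr x : x * d = 0 <-> x = 0.
  by split=> [cx|->]; rewrite ?mul0r // -(mulr1 x) -dc mulrA cx mul0r.
(* Left multiplication by [c] conjugates the left idempotent and leaves right annihilators
   unchanged. *)
exists (c * p * d), q; split => //.
- by rewrite /idempotents /= !mulrA -(mulrA _ d c) dc mulr1 (mulrA2 pp).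
- apply/seteqP; split=> x; rewrite /ann_l /= !mulrA => xca.
    by apply/cancelr; have : ann_l a (x * c) by []; rewrite ap.
  by move/cancelr: xca => xca; have : ann_l p (x * c) by []; rewrite -ap.
- rewrite -aq; apply/seteqP; split=> x; rewrite /ann_r /= -!mulrA.
    by move/cancel.
  by move=> ->; rewrite mulr0.
- by rewrite !mulrA -!(mulrA _ d c) dc !mulr1 -!mulrA pa qa.
Qed.

Lemma minus_le_invertible_mull (A : nzRingType) (c a b : A) : invertible c ->
  minus_le a b <-> minus_le (c * a) (c * b).
Proof.
move=> [d [cd dc]]; split; first exact: (minus_le_mull cd dc).
by move=> /(minus_le_mull dc cd); rewrite !mulrA dc !mul1r.
Qed.

Lemma minus_le_iso_or_antiiso (F : fieldType) (A B : algType F) (Psi : A -> B) a b :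
  alg_isomorphism Psi \/ alg_antiisomorphism Psi ->
  minus_le a b <-> minus_le (Psi a) (Psi b).
Proof.
have Psi0 : linear Psi -> Psi 0 = 0.
  by move=> lPsi; have := lPsi (-1) 0 0; rewrite scaleN1r oppr0 addr0 scaleN1r addNr.
case=> -[/Psi0 P0 bPsi mPsi]; first exact: minus_le_bij_morph.
apply: iff_trans (iff_sym (minus_le_opposite _ _)).
exact: (@minus_le_bij_morph A (opposite B) Psi a b bPsi P0 mPsi).
Qed.

End MinusOrderInvariance.

(** * The Gelfand-Mazur theorem for corners of a normed algebra *)

Section GelfandMazur.
Variable R : realType.
Import Normc.

Lemma normc_ge0 (z : R[i]) : 0 <= normc z.
Proof. by case: z => a b; exact: sqrtr_ge0. Qed.

Lemma normcX (z : R[i]) n : normc (z ^+ n) = normc z ^+ n.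
Proof. by elim: n => [|n IHn]; rewrite ?expr0 ?normc1 // !exprS normcM IHn. Qed.

Lemma normc_real (r : R) : 0 <= r -> normc (r%:C)%C = r.
Proof. by move=> r0; rewrite /= expr0n addr0 sqrtr_sqr ger0_norm. Qed.

Lemma ler_Re_normc (z : R[i]) : `|complex.Re z| <= normc z.
Proof. by rewrite -lecR; exact: normc_ge_Re. Qed.

Lemma ler_Im_normc (z : R[i]) : `|complex.Im z| <= normc z.
Proof.
case: z => a b /=; rewrite -(sqrtr_sqr b) ler_wsqrtr //.
by rewrite lerDr sqr_ge0.
Qed.

Lemma normc_le_sum (z : R[i]) : normc z <= `|complex.Re z| + `|complex.Im z|.
Proof.
case: z => a b /=.
rewrite -(@ler_pXn2r _ 2) ?nnegrE ?sqrtr_ge0 ?addr_ge0 //.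
rewrite sqr_sqrtr ?addr_ge0 ?sqr_ge0 // sqrrD !real_normK ?num_real //.
by rewrite lerD2r lerDl mulrn_wge0 // mulr_ge0.
Qed.

Lemma lipschitz_coercive_min (g : R[i] -> R) (D : R) :
  (forall z w, g z - g w <= normc (z - w)) ->
  (forall z, D < normc z -> g 0 <= g z) -> exists z0, forall z, g z0 <= g z.
Proof.
move=> g_lip g_far.
have lip z w : `|g z - g w| <= `|complex.Re (z - w)| + `|complex.Im (z - w)|.
  apply: le_trans (normc_le_sum _); rewrite ler_norml g_lip andbT lerNl opprB.
  by apply: le_trans (g_lip _ _) _; rewrite -normcN opprB.
pose G (p : R * R) := g (p.1 +i* p.2)%C.
(* The absolute value keeps [0] in the square even when [D] is negative. *)
pose I : set R := `[- `|D|, `|D|]%classic; pose K : set (R * R) := I `*` I.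
have K0 : K (0, 0) by split; rewrite /I /= in_itv /= oppr_le0 normr_ge0.
have cK : compact K by apply: compact_setX; exact: segment_compact.
have cG : {within K, continuous G}.
  apply: continuous_subspaceT => p; apply/cvgrPdist_le => eps eps0.
  near=> q; apply: le_trans (lip _ _) _; rewrite /=.
  have : ball p (eps / 2) q.
    by near: q; apply: (@nbhsx_ballx _ (R * R)%type p); exact: divr_gt0.
  move=> [/ltW b1 /ltW b2]; rewrite [leRHS](splitr eps); exact: lerD.
have [[s t] _ stmin] := compact_EVT_min (ex_intro _ _ K0) cK cG.
exists (s +i* t)%C => z.
have [zD|/g_far] := leP (normc z) D; last first.
  apply: le_trans; have := stmin (0, 0); rewrite inE; apply; exact: K0.
have DD : D <= `|D| := ler_norm D.
have := stmin (complex.Re z, complex.Im z); rewrite inE /G /=.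
have -> : (complex.Re z +i* complex.Im z)%C = z by case: z {zD}.
apply; split; rewrite /I /= in_itv /= -ler_norml.
  exact: le_trans (ler_Re_normc z) (le_trans zD DD).
exact: le_trans (ler_Im_normc z) (le_trans zD DD).
Unshelve. all: by end_near. Qed.

Lemma prim_root_exists n : (0 < n)%N -> exists w : R[i], n.-primitive_root w.
Proof.
move=> n_gt0; pose p : {poly R[i]} := 'X^n - 1.
have [r Dp] := closed_field_poly_normal p.
rewrite (monicP _) ?monicXnsubC // scale1r in Dp.
have rn1 : all n.-unity_root r by apply/allP=> z; rewrite -root_prod_XsubC -Dp.
have sz_r : (n < (size r).+1)%N.
  by rewrite -(size_prod_XsubC r id) -Dp size_XnsubC.
have [|w] := hasP (has_prim_root n_gt0 rn1 _ sz_r); last by exists w.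
by rewrite -separable_prod_XsubC -Dp separable_Xn_sub_1 // pnatr_eq0 -lt0n.
Qed.

Variable A : normedAlgType R[i].
Implicit Types x y : A.

Definition rnorm x : R := complex.Re (algnorm x).

Lemma rnormE x : (rnorm x)%:C%C = algnorm x.
Proof.
rewrite /rnorm RRe_real // ger0_real //; exact: (@normr_ge0 _ (normed_space A) x).
Qed.

Lemma rnorm_ge0 x : 0 <= rnorm x.
Proof. by rewrite -lecR rnormE; exact: (@normr_ge0 _ (normed_space A) x). Qed.

Lemma rnorm_eq0 x : rnorm x = 0 -> x = 0.
Proof. by move=> x0; apply: algnorm0_eq0; rewrite -rnormE x0. Qed.

Lemma rnorm_gt0 x : x <> 0 -> 0 < rnorm x.
Proof.
move=> x0; rewrite lt_neqAle rnorm_ge0 andbT eq_sym; apply/eqP.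
by move/rnorm_eq0.
Qed.

Lemma rnormD x y : rnorm (x + y) <= rnorm x + rnorm y.
Proof. by rewrite -lecR rmorphD /= !rnormE; exact: ler_algnormD. Qed.

Lemma rnormM x y : rnorm (x * y) <= rnorm x * rnorm y.
Proof. by rewrite -lecR rmorphM /= !rnormE; exact: ler_algnormM. Qed.

Lemma rnormX x n : rnorm (x ^+ n.+1) <= rnorm x ^+ n.+1.
Proof.
elim: n => [|n IHn]; first by rewrite !expr1.
rewrite exprS (exprS (rnorm x)); apply: le_trans (rnormM _ _) _.
by rewrite ler_wpM2l ?rnorm_ge0.
Qed.

Lemma rnormZ (k : R[i]) x : rnorm (k *: x) = normc k * rnorm x.
Proof.
by apply: (@complexI R); rewrite rmorphM /= !rnormE algnormZ; case: k.
Qed.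

Lemma rnormN x : rnorm (- x) = rnorm x.
Proof. by rewrite -scaleN1r rnormZ normcN normc1 mul1r. Qed.

Lemma rnorm_sum n (G : 'I_n -> A) : rnorm (\sum_i G i) <= \sum_i rnorm (G i).
Proof.
elim/big_ind2: _ => [|x a y b xa yb|//]; last exact: le_trans (rnormD _ _) (lerD xa yb).
by rewrite /rnorm -(scale0r 0) algnormZ normr0 mul0r.
Qed.

(** * Resolvents defined on the whole complex plane *)

Section Resolvent.
Variables (x e : A) (r : R[i] -> A).
Hypothesis e0 : e <> 0.
Hypotheses (re : forall z, r z * e = r z) (er : forall z, e * r z = r z).
Hypothesis rl : forall z, r z * (x - z *: e) = e.
Hypothesis rr : forall z, (x - z *: e) * r z = e.

Lemma resolvent_identity z w : r z = r w + (z - w) *: (r z * r w).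
Proof.
have : r z * ((x - w *: e) - (x - z *: e)) * r w = r z - r w.
  by rewrite mulrBr rl mulrBl -mulrA rr re er.
rewrite opprB addrC addrA subrK -scalerBl -scalerAr -scalerAl re => rE.
by rewrite rE addrC subrK.
Qed.

Lemma resolvent_gt0 z : 0 < rnorm (r z).
Proof. by apply: rnorm_gt0 => r0; apply: e0; rewrite -(rl z) r0 mul0r. Qed.

Let m z := (rnorm (r z))^-1.

(** Take norms in the resolvent identity and divide by [rnorm (r w) * rnorm (r z)]. *)
Lemma resolvent_lipschitz z w : m z - m w <= normc (z - w).
Proof.
have z0 := resolvent_gt0 z; have w0 := resolvent_gt0 w.
have : rnorm (r w) <= rnorm (r z) + normc (z - w) * (rnorm (r w) * rnorm (r z)).
  rewrite [in leLHS](resolvent_identity w z) -(normcN (z - w)) opprB.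
  apply: le_trans (rnormD _ _) _; rewrite lerD2l rnormZ ler_wpM2l //.
    exact: normc_ge0.
  exact: rnormM.
rewrite -lerBlDl -ler_pdivrMr ?mulr_gt0 //; apply: le_trans.
rewrite mulrBl invfM mulrA divff ?gt_eqF // mul1r mulrCA divff ?gt_eqF // mulr1.
by [].
Qed.

Lemma resolvent_coercive z : normc z <= rnorm x + rnorm e * m z.
Proof.
have z0 := resolvent_gt0 z.
have : z *: r z = x * r z - e.
  by rewrite -(rr z) mulrBl -scalerAl er opprB addrC subrK.
move/(congr1 rnorm); rewrite rnormZ => zE.
rewrite -(ler_pM2r z0) zE mulrDl -mulrA mulVf ?gt_eqF // mulr1.
by apply: le_trans (rnormD _ _) _; rewrite rnormN lerD2r; exact: rnormM.
Qed.

(** The Neumann series with an exact remainder, by iterating the resolvent identity; no convergence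
    is involved. *)
Lemma resolvent_expansion z t n :
  r (z + t) = \sum_(j < n) t ^+ j *: r z ^+ j.+1 + t ^+ n *: (r (z + t) * r z ^+ n).
Proof.
elim: n => [|n IHn]; first by rewrite big_ord0 add0r !expr0 scale1r mulr1.
rewrite big_ord_recr /= -addrA [LHS]IHn; congr (_ + _).
rewrite {1}(resolvent_identity (z + t) z) mulrDl scalerDr -exprS; congr (_ + _).
by rewrite addrC addKr -scalerAl scalerA -exprSr -mulrA -exprS.
Qed.

(* Averaging over the vertices of a regular polygon kills the powers
   [t ^+ j] with [0 < j < n]. *)
Lemma resolvent_average z (s w : R[i]) n : (0 < n)%N -> n.-primitive_root w ->
  \sum_(k < n) r (z + s * w ^+ k) =
  n%:R *: r z + s ^+ n *: ((\sum_(k < n) r (z + s * w ^+ k)) * r z ^+ n).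
Proof.
move=> n0 wn.
under [LHS]eq_bigr do rewrite (resolvent_expansion _ _ n).
rewrite big_split /=; congr (_ + _); last first.
  rewrite mulr_suml scaler_sumr; apply: eq_bigr => k _; congr (_ *: _).
  by rewrite exprMn -exprM mulnC exprM (prim_expr_order wn) expr1n mulr1.
rewrite exchange_big /=; case: n n0 wn => // n _ wn.
rewrite big_ord_recl [X in _ + X]big1 ?addr0 => [|j _].
  rewrite (eq_bigr (fun=> r z)) => [|k _]; last by rewrite expr0 scale1r expr1.
  by rewrite sumr_const card_ord scaler_nat.
rewrite -scaler_suml (eq_bigr (fun k : 'I_n.+1 => s ^+ lift ord0 j *
    (w ^+ lift ord0 j) ^+ k)) => [|k _]; last by rewrite exprMn -!exprM mulnC.
rewrite -mulr_sumr; have := subrX1 (w ^+ lift ord0 j) n.+1.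
rewrite -exprM mulnC exprM (prim_expr_order wn) expr1n subrr => /esym/eqP.
rewrite mulf_eq0 subr_eq0 -[X in _ == X](expr0 w) (eq_prim_root_expr wn) mod0n.
rewrite modn_small ?ltn_ord // => /orP[//|/eqP ->].
by rewrite mulr0 scale0r.
Qed.

(* An average of [n] numbers that are at most [M] and whose deficit from [M] is
   [O(4^-n)] has all its terms within [O(n 4^-n)] of [M]. *)
Lemma resolvent_min_shift z0 : (forall z, m z0 <= m z) ->
  m (z0 + (m z0 / 4)%:C%C) = m z0.
Proof.
move=> z0min; pose M := rnorm (r z0); have M0 : 0 < M := resolvent_gt0 z0.
have rM z : rnorm (r z) <= M.
  by rewrite -lef_pV2 ?posrE ?resolvent_gt0 //; exact: z0min.
(* With this radius, averaging over [n.+1] vertices leaves a remainder of norm at most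
   [n.+1%:R * M * 4^-1 ^+ n.+1]. *)
pose s : R := m z0 / 4; have s0 : 0 < s by rewrite divr_gt0 ?invr_gt0.
have sM : s * M = 4^-1 by rewrite /s /m mulrAC mulVf ?mul1r // gt_eqF.
suff Mle : M <= rnorm (r (z0 + (s%:C)%C)).
  by congr (_^-1); apply/eqP; rewrite eq_le rM.
apply/ler_addgt0Pl => eps eps0.
(* This suffices because [n.+1 <= 2 ^ n.+1]. *)
have [n nM] : exists n, M * 2^-1 ^+ n.+1 <= eps.
  exists (Num.bound (M / eps)); rewrite exprVn ler_pdivrMr ?exprn_gt0 //.
  rewrite mulrC -ler_pdivrMr //; apply: ltW.
  apply: lt_trans (archi_boundP _) _; first by rewrite divr_ge0 // ltW.
  by rewrite -natrX ltr_nat (ltn_trans (ltnSn _)) // ltn_expl.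
have [w wn] := prim_root_exists (ltn0Sn n).
have w1 k : normc (w ^+ k) = 1.
  rewrite normcX; suff -> : normc w = 1 by rewrite expr1n.
  apply/eqP; rewrite -(@pexpr_eq1 _ _ n.+1) ?normc_ge0 // -normcX.
  by rewrite (prim_expr_order wn) normc1.
pose S := \sum_(k < n.+1) r (z0 + (s%:C)%C * w ^+ k).
have : n.+1%:R *: r z0 = S - ((s%:C)%C ^+ n.+1 *: (S * r z0 ^+ n.+1)).
  by rewrite {1}/S resolvent_average // addrK.
move/(congr1 rnorm); rewrite rnormZ -/M => nM1.
have normc_nat : normc (n.+1%:R : R[i]) = n.+1%:R.
  by rewrite -(rmorph_nat (real_complex R)) normc_real.
(* Only the vertex [k = 0] is kept; the other [n] terms are bounded by [M]. *)
have SM : rnorm S <= rnorm (r (z0 + (s%:C)%C)) + n%:R * M.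
  apply: le_trans (rnorm_sum _) _; rewrite big_ord_recl expr0 mulr1 lerD2l.
  apply: le_trans (ler_sum _ (fun i _ => rM _)) _.
  by rewrite sumr_const card_ord mulr_natl.
have SM' : rnorm S <= n.+1%:R * M.
  by apply: le_trans SM _; rewrite -natr1 mulrDl mul1r addrC lerD2l.
have : n.+1%:R * M <= rnorm S + s ^+ n.+1 * (n.+1%:R * M * M ^+ n.+1).
  rewrite normc_nat in nM1; rewrite [leLHS]nM1.
  apply: le_trans (rnormD _ _) _; rewrite lerD2l rnormN rnormZ.
  rewrite normcX (normc_real (ltW s0)) ler_pM2l ?exprn_gt0 //.
  apply: le_trans (rnormM _ _) _; rewrite ler_pM ?rnorm_ge0 //; exact: rnormX.
rewrite mulrCA -exprMn sM => nMle.
have : n.+1%:R * M * 4^-1 ^+ n.+1 <= eps.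
  apply: le_trans nM; rewrite mulrAC mulrC ler_pM2l //.
  have -> : 4^-1 = 2^-1 * 2^-1 :> R by rewrite -invfM -natrM.
  rewrite exprMn mulrA ler_piMl ?exprn_ge0 ?invr_ge0 //.
  rewrite exprVn ler_pdivrMr ?exprn_gt0 // mul1r -natrX ler_nat.
  by apply: ltnW; exact: ltn_expl.
move=> epsle; have := le_trans nMle (lerD SM epsle).
by rewrite -natr1 mulrDl mul1r -addrA addrCA lerD2l [eps + _]addrC.
Qed.

(** In place of Liouville's theorem: [m] attains a minimum, [resolvent_min_shift] repeats its value
    at all [z0 + k%:R * d], and these points leave every disk, against [resolvent_coercive]. *)
Lemma resolvent_not_entire : False.
Proof.
have e_gt0 : 0 < rnorm e by exact: rnorm_gt0.
have [z|z0 z0min] :=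
  @lipschitz_coercive_min m (rnorm x + rnorm e * m 0) resolvent_lipschitz.
  move=> far; have := lt_le_trans far (resolvent_coercive z).
  by rewrite ltrD2l ltr_pM2l // => /ltW.
pose d := m z0 / 4; have d0 : 0 < d by rewrite divr_gt0 // invr_gt0 resolvent_gt0.
have mk k : m (z0 + (k%:R * d)%:C%C) = m z0.
  elim: k => [|k IHk]; first by rewrite mul0r addr0.
  rewrite -natr1 mulrDl mul1r rmorphD /= addrA /d -{2}IHk resolvent_min_shift //.
  by move=> z; rewrite IHk.
pose C := rnorm x + rnorm e * m z0 + normc z0.
have C0 : 0 <= C.
  rewrite !addr_ge0 ?rnorm_ge0 ?normc_ge0 ?mulr_ge0 ?rnorm_ge0 //.
  by rewrite invr_ge0 rnorm_ge0.
pose k := Num.bound (C / d); have kC : C / d < k%:R.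
  by apply: archi_boundP; rewrite divr_ge0 // ltW.
have := resolvent_coercive (z0 + (k%:R * d)%:C%C); rewrite mk.
apply/negP; rewrite -ltNge -(ltrD2r (normc z0)) -/C.
rewrite ltr_pdivrMr // in kC; apply: lt_le_trans kC _.
rewrite -[leLHS]normc_real; last by rewrite mulr_ge0 // ltW.
have := le_normcD (z0 + (k%:R * d)%:C%C) (- z0).
by rewrite normcN (addrAC z0) subrr add0r.
Qed.

End Resolvent.

Lemma gelfand_mazur_corner (e : A) : e * e = e -> e <> 0 ->
  (forall a, e * a * e <> 0 -> exists b, (e * b * e) * (e * a * e) = e) ->
  rank_le1 e.
Proof.
move=> ee e0 inv a; apply: contrapT => /forallNP na.
pose x := e * a * e.
have xz z : x - z *: e = e * (a - z *: 1) * e.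
  by rewrite mulrBr mulrBl -scalerAr mulr1 -scalerAl ee.
have x0 z : e * (a - z *: 1) * e <> 0.
  by rewrite -xz => /eqP; rewrite subr_eq0 => /eqP /na.
have [b bE] := choice (fun z => inv _ (x0 z)).
pose r z := e * b z * e.
have rl z : r z * (x - z *: e) = e by rewrite xz; exact: bE.
(* The left inverse [r z] has a left inverse itself, which must be [x - z *: e]. *)
have rr z : (x - z *: e) * r z = e.
  have [|s sE] := inv (b z) _.
    by rewrite -/(r z) => r0; apply: e0; rewrite -(rl z) r0 mul0r.
  have ex : e * (x - z *: e) = x - z *: e by rewrite xz !mulrA ee.
  have : e * s * e * r z * (x - z *: e) = x - z *: e by rewrite sE ex.
  by rewrite -mulrA rl -(mulrA (e * s)) ee => <-.
apply: (@resolvent_not_entire x e r) => //.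
- by move=> z; rewrite /r -mulrA ee.
- by move=> z; rewrite /r !mulrA ee.
Qed.

End GelfandMazur.

(** * Semisimple rings, prime rings and minimal left ideals *)

Section Socle.
Variable A : nzRingType.
Implicit Types (a b e p x y : A) (L M : set A).

(** If a maximal left ideal [M] misses [a], then [1 = b * a + y] with [y] in [M]. As [b * a] squares
    to zero, [1 + b * a] is a left inverse of [y], so [M] contains [1]. *)
Lemma semisimple_elt_semiprime : semisimple A -> elt_semiprime A.
Proof.
move=> ssA a axa; suff : jacobson_radical a by rewrite ssA.
move=> M [[M0 MD Ml] MT Mmax]; apply: contrapT => nMa.
pose J := [set x | exists b y, M y /\ x = b * a + y].
have JL : left_ideal J.
  split; first by exists 0, 0; rewrite mul0r add0r.
    move=> _ _ [b [y [My ->]]] [b' [y' [My' ->]]]; exists (b + b'), (y + y').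
    by split; [exact: MD|rewrite mulrDl addrACA].
  move=> c _ [b [y [My ->]]]; exists (c * b), (c * y).
  by split; [exact: Ml|rewrite mulrDr mulrA].
have MJ : M `<=` J by move=> y My; exists 0, y; rewrite mul0r add0r.
case: (Mmax J JL MJ) => JE.
  by apply: nMa; rewrite -JE; exists 1, 0; rewrite mul1r addr0.
have [b [y [My yE]]] : J 1 by rewrite JE.
apply: MT; apply/seteqP; split => // x _; rewrite -(mulr1 x); apply: (Ml x).
have <- : (1 + b * a) * y = 1; last exact: Ml.
have -> : y = 1 - b * a by rewrite yE addrC addKr.
rewrite mulrBr mulr1 mulrDl mul1r opprD addrA addrK -!mulrA (mulrA a) axa mulr0.
by rewrite subr0.
Qed.

Lemma prime_ring_elt_prime : prime_ring A -> elt_prime A.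
Proof.
move=> pA a b ab.
(* [I] is the left annihilator of [A * b] and [J] the right annihilator of [I]; they contain [a] and
   [b]. *)
pose I := [set x | forall t, x * t * b = 0].
pose J := [set y | forall x, I x -> x * y = 0].
have II : two_sided_ideal I.
  split; [split|] => [t|x y Ix Iy t|c x Ix t|c x Ix t].
  - by rewrite !mul0r.
  - by rewrite !mulrDl Ix Iy addr0.
  - by rewrite -!mulrA (mulrA x) Ix mulr0.
  - by rewrite -(mulrA x) Ix.
have JJ : two_sided_ideal J.
  split; [split|] => [x _|y z Jy Jz x Ix|c y Jy x Ix|c y Jy x Ix].
  - by rewrite mulr0.
  - by rewrite mulrDr Jy // Jz // addr0.
  - by rewrite mulrA Jy //; case: II => _; apply.
  - by rewrite mulrA Jy // mul0r.
have [|IE|JE] := pA I J II JJ; first by move=> x y Ix; apply.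
  by left; suff : I a by rewrite IE.
right; suff : J b by rewrite JE.
by move=> x Ix; rewrite -(mulr1 x) Ix.
Qed.

(* Brauer's lemma *)
Lemma minimal_left_ideal_idempotent L : elt_semiprime A -> minimal_left_ideal L ->
  exists e, [/\ e * e = e, e <> 0, forall x, L x -> x * e = x &
    forall a, e * a * e <> 0 -> exists b, (e * b * e) * (e * a * e) = e].
Proof.
move=> sA [[L0 LD Ll] Ln0 Lmin].
have [z Lz z0] : exists2 z, L z & z <> 0.
  apply: contrapT => nz; apply: Ln0; apply/seteqP; split=> [x Lx|x -> //].
  by apply: contrapT => x0; apply: nz; exists x.
have minP J : left_ideal J -> J `<=` L -> (exists2 x, J x & x <> 0) -> J = L.
  by move=> Jl JL [x Jx x0]; case: (Lmin J Jl JL) => // JE; move: Jx; rewrite JE.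
have [a zaz] := elt_semiprimeP sA z0.
pose y := a * z; have Ly : L y by exact: Ll.
have Lyl x : left_ideal [set t | exists2 u, L u & t = u * x].
  split; first by exists 0; rewrite ?mul0r.
    by move=> _ _ [u Lu ->] [v Lv ->]; exists (u + v); [exact: LD|rewrite mulrDl].
  by move=> c _ [u Lu ->]; exists (c * u); [exact: Ll|rewrite mulrA].
(* [L * y] is a nonzero left ideal inside [L], so it contains [y = e * y]. Right multiplication by
   [y] is injective on [L], which will make [e] idempotent. *)
have [e Le ye] : [set t | exists2 u, L u & t = u * y] y.
  rewrite (minP _ (Lyl y)) //; first by move=> _ [u _ ->]; exact: Ll.
  by exists (z * y); [exists z|rewrite /y mulrA].
have y0 : y <> 0 by move=> y0; apply: zaz; rewrite -mulrA -/y y0 mulr0.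
have ann0 x : L x -> x * y = 0 -> x = 0.
  move=> Lx xy; apply: contrapT => x0.
  suff LE : [set t | L t /\ t * y = 0] = L.
    by apply: zaz; have : L z by []; rewrite -LE => -[_]; rewrite /y mulrA.
  apply: minP => [|t []//|]; last by exists x.
  split=> [|u v [Lu uy] [Lv vy]|c u [Lu uy]]; first by rewrite /= mul0r.
    by split; [exact: LD|rewrite mulrDl uy vy addr0].
  by split; [exact: Ll|rewrite -mulrA uy mulr0].
have ee : e * e = e.
  apply/eqP; rewrite -subr_eq0; apply/eqP; apply: ann0; last first.
    by rewrite mulrBl -mulrA -!ye subrr.
  by apply: LD; [exact: Ll|rewrite -mulN1r; exact: Ll].
have e0 : e <> 0 by move=> e0; apply: y0; rewrite ye e0 mul0r.
have Ael x : L x -> left_ideal [set t | exists b, t = b * x].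
  move=> Lx; split; first by exists 0; rewrite mul0r.
    by move=> _ _ [u ->] [v ->]; exists (u + v); rewrite mulrDl.
  by move=> c _ [u ->]; exists (c * u); rewrite mulrA.
have Aex x : L x -> x <> 0 -> forall t, L t -> exists b, t = b * x.
  move=> Lx x0 t; rewrite -(minP _ (Ael x Lx)) //; first by move=> _ [b ->]; exact: Ll.
  by exists x => //; exists 1; rewrite mul1r.
exists e; split=> // [x Lx|b ebe].
  by have [c ->] := Aex e Le e0 x Lx; rewrite -mulrA ee.
have [c cE] := Aex (e * b * e) (Ll _ _ Le) ebe e Le.
exists c; transitivity (e * (c * (e * b * e))); last by rewrite -cE.
by rewrite !mulrA (mulrA2 ee).
Qed.

End Socle.

(** * Rank-one elements from the socle *)

Section EnoughRankOne.
Variables (R : realType) (A : normedAlgType R[i]).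
Hypothesis sA : elt_semiprime A.

Lemma minimal_left_ideal_rank_one (L : set A) : minimal_left_ideal L ->
  exists e, [/\ e <> 0, rank_le1 e & forall x, L x -> x * e = x].
Proof.
move=> /(minimal_left_ideal_idempotent sA)[e [ee e0 Le inv]]; exists e; split => //.
exact: gelfand_mazur_corner.
Qed.

(** If [u * (a * b) * u = k *: u] with [k] nonzero, then [k^-1 *: (b * u)] is an outer inverse of
    [a]. *)
Lemma enough_rank_one_mul_neq0 :
  (forall a : A, a <> 0 -> exists2 u, rank_le1 u & u * a <> 0) -> enough_rank_one A.
Proof.
move=> H a /H[u ru ua]; have [b uabua] := elt_semiprimeP sA ua.
have [k kE] := ru (a * b); have k0 : k != 0.
  apply/eqP => k0; apply: uabua; transitivity (u * (a * b) * u * a).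
    by rewrite !mulrA.
  by rewrite kE k0 scale0r mul0r.
exists (k^-1 *: (b * u)); split.
- move=> bu; apply: uabua; rewrite -!mulrA (mulrA b).
  have -> : b * u = k *: (k^-1 *: (b * u)) by rewrite scalerA mulfV // scale1r.
  by rewrite bu scaler0 mul0r !mulr0.
- by rewrite scalerAl; exact: rank_le1_mull.
- rewrite -!scalerAl -scalerAr; congr (_ *: _).
  transitivity (k^-1 *: (b * (u * (a * b) * u))); first by rewrite !mulrA.
  by rewrite kE -scalerAr scalerA mulVf // scale1r.
Qed.

(** The right annihilator [J] of the socle meets the socle in zero by semiprimeness, so it is zero
    by essentiality. Hence some [y] in a minimal left ideal has [y * a] nonzero, and [y = y * e]
    passes this on to [e * a]. *)
Lemma essential_socle_enough_rank_one : essential (@socle A) -> enough_rank_one A.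
Proof.
move=> [[_ soc_r] _ ess]; apply: enough_rank_one_mul_neq0 => a a0.
pose J : set A := [set x | forall s, socle s -> s * x = 0].
have JJ : two_sided_ideal J.
  split; [split|] => [s _|x y Jx Jy s ss|c x Jx s ss|c x Jx s ss].
  - by rewrite mulr0.
  - by rewrite mulrDr Jx // Jy // addr0.
  - by rewrite mulrA Jx //; exact: soc_r.
  - by rewrite mulrA Jx // mul0r.
have socJ x : socle x -> J x -> x = 0.
  by move=> sx Jx; apply: sA => y; apply: Jx; exact: soc_r.
have nJa : ~ J a.
  move=> Ja; apply: (ess J JJ) => [JE|]; first by move: Ja; rewrite JE.
  apply/seteqP; split=> [x [sx Jx]|x ->]; first exact: socJ.
  split; last by case: JJ => -[].
  by exists [::] => //; rewrite big_nil.
have [s [[t tL ->] ta]] : exists s, socle s /\ s * a <> 0.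
  apply: contrapT => ns; apply: nJa => s ss; apply: contrapT => sa.
  by apply: ns; exists s.
have [y yt ya] : exists2 y, y \in t & y * a <> 0.
  apply: contrapT => ny; apply: ta; rewrite mulr_suml big_seq big1 // => y yt.
  by apply: contrapT => ya; apply: ny; exists y.
have [L /minimal_left_ideal_rank_one[e [e0 re Le]] Ly] := tL y yt.
by exists e => // ea; apply: ya; rewrite -(Le y Ly) -mulrA ea mulr0.
Qed.

Lemma prime_socle_enough_rank_one : elt_prime A -> @socle A <> [set 0] ->
  enough_rank_one A.
Proof.
move=> pA soc0; apply: enough_rank_one_mul_neq0 => a a0.
have [L Lmin] : exists L : set A, minimal_left_ideal L.
  apply: contrapT => nL; apply: soc0; apply/seteqP; split=> [_ [s sL ->]|_ ->].
    rewrite /= big_seq big1 // => y /sL[L Lmin _].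
    by case: nL; exists L.
  by exists [::] => //; rewrite big_nil.
have [e [e0 re _]] := minimal_left_ideal_rank_one Lmin.
have [b eba] := elt_primeP pA e0 a0; exists (e * b) => //.
exact: rank_le1_mulr.
Qed.

End EnoughRankOne.

Theorem theorem3p6 (R : realType) (A : banachAlgType R[i])
    (B : cstarAlgType R[i]) (Phi : {linear A -> B})
    (A_semisimple : semisimple A) (A_essential_socle : essential (@socle A))
    (B_prime : prime_ring B) (B_socle : @socle B <> [set 0])
    (Phi_surj : forall y : B, exists x : A, Phi x = y) :
  (forall a b : A, minus_le a b <-> minus_le (Phi a) (Phi b)) <->
  (exists c : B, exists Psi : A -> B,
     [/\ invertible c, alg_isomorphism Psi \/ alg_antiisomorphism Psi
       & forall x : A, Phi x = c * Psi x]).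
Proof.
have sA := semisimple_elt_semiprime A_semisimple.
have pB := prime_ring_elt_prime B_prime.
have eA := essential_socle_enough_rank_one sA A_essential_socle.
have eB := prime_socle_enough_rank_one (elt_prime_semiprime pB) pB B_socle.
split; first exact: minus_le_preserver_iso_or_antiiso.
move=> [c [Psi [cinv iPsi PsiE]]] a b; rewrite !PsiE.
apply: iff_trans (minus_le_iso_or_antiiso a b iPsi) _.
exact: minus_le_invertible_mull.
Qed.
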